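(* Let $\mathbb{F}$ be an algebraically closed field. (1) For every countable (i.e. countably infinite) locally standard Hamming space $S$ there exist a unital locally matrix algebra $A$ over $\mathbb{F}$ of countably infinite dimension and a Cartan subalgebra $H$ of $A$ such that $S\cong E(H)$ as Hamming spaces and $\mathbf{st}(S)=\mathbf{st}(A)$. (2) Let $A_1$, $A_2$ be unital locally matrix algebras over $\mathbb{F}$ of countably infinite dimension, with Cartan subalgebras $H_1$, $H_2$ respectively. Then the Hamming spaces $E(H_1)$ and $E(H_2)$ are isomorphic if and only if $A_1\cong A_2$ as $\mathbb{F}$-algebras.
   Context: Hamming spaces. A Boolean algebra is a commutative associative algebra over $\mathbb{Z}/2\mathbb{Z}$ satisfying $x^2=x$. A (unital) Hamming space $(H,r)$ is a Boolean algebra $H$ with $1$ and a ''rang'' function $r:H\to[0,1]$ such that $r(a)=0$ iff $a=0$; $r(a)=1$ iff $a=1$; and $r(a+b)=r(a)+r(b)$ whenever $ab=0$. Isomorphisms of Hamming spaces are isomorphisms of unital Boolean algebras preserving the rang functions; a subspace is a subalgebra containing $1$ with the restricted rang function. The standard Hamming space $H_n$ is $(\mathbb{Z}/2\mathbb{Z})^n$ with $r_{H_n}(x_1,\ldots,x_n)=\frac1n(x_1+\cdots+x_n)$ (sum of $x_i\in\{0,1\}$ in $\mathbb{R}$). A Hamming space is locally standard if every finite collection of its elements lies in a subspace isomorphic to some $H_m$, $m\ge1$. Locally matrix algebras. An associative $\mathbb{F}$-algebra $A$ with unit $1$ is a unital locally matrix algebra if for every finite collection $a_1,\ldots,a_s\in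 A$ there is a subalgebra $A'\subset A$ with $1,a_1,\ldots,a_s\in A'$ and $A'\cong M_n(\mathbb{F})$ for some $n\ge1$. Steinitz numbers. A Steinitz number is a formal product $\prod_{p} p^{r_p}$ over all primes $p$, with $r_p\in\mathbb{N}\cup\{0,\infty\}$. The least common multiple of a set of positive integers is the Steinitz number in which the exponent of each prime $p$ is the supremum of the exponents of $p$ in the elements of the set. For a locally standard Hamming space $S$, $\mathbf{st}(S)$ is the least common multiple of the set of all $n\ge1$ such that $S$ has a subspace isomorphic to $H_n$. For a unital locally matrix algebra $A$, $\mathbf{st}(A)$ is the least common multiple of the set of all $n\ge1$ such that there is a subalgebra $A'$ with $1\in A'\subset A$, $A'\cong M_n(\mathbb{F})$. Relative rang and $E(C)$. For $a\in A$ choose a subalgebra $A'\subset A$ with $1,a\in A'$, $A'\cong M_n(\mathbb{F})$; the relative rang of $a$ is $r(a)=\frac1n\,\mathrm{rank}(a)$, the rank being that of $a$ as an $n\times n$ matrix; it does not depend on the choice of $A'$. For a commutative subalgebra $C\subset A$ with $1\in C$, $E(C)$ denotes the set of all idempotents of $C$ (including $0$ and $1$), with Boolean product $ef$, Boolean sum $e+f-2ef$, and rang function the restriction of $r$; this is a Hamming space. Cartan subalgebras. A subalgebra of $M_n(\mathbb{F})$ is a Cartan subalgebra if it is spanned by $n$ pairwise orthogonal nonzero idempotents (equivalently is isomorphic to $\mathbb{F}^n$). A decomposition $A=\bigotimes_{i=1}^\infty B_i$ into finite dimensional matrix algebras means: the $B_i$ are pairwise commuting subalgebras of $A$ containing $1$,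 each $B_i\cong M_{n_i}(\mathbb{F})$ for some $n_i\geq 1$, the multiplication maps $B_1\otimes_{\mathbb{F}}\cdots\otimes_{\mathbb{F}} B_k\to A$ are injective for all $k$, and $A$ is the union of their images. A subalgebra $H\subset A$ is a Cartan subalgebra of $A$ if there exist such a decomposition and Cartan subalgebras $C_i$ of $B_i$ such that $H=\bigotimes_{i=1}^\infty C_i$, i.e. $H$ is the subalgebra of $A$ generated by all $C_i$. *)

(* Defs.v *)
From HB Require Import structures.
From mathcomp Require Import all_boot all_order all_algebra.
From mathcomp Require Import mathcomp_extra boolp classical_sets functions.
From mathcomp Require Import cardinality reals.

Set Implicit Arguments.
Unset Strict Implicit.
Unset Printing Implicit Defensive.

Import Order.TTheory GRing.Theory Num.Theory.

Local Open Scope classical_set_scope.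
Local Open Scope ring_scope.

(* The carrier of a [comAlgType] is nontrivial; here this is implied by the
   requirements on the rang function at 0 and 1. *)
Record hammingSpace (R : realType) := HammingSpace {
  hamming_car :> comAlgType 'F_2;
  rang : hamming_car -> R;
  hamming_idem : forall x : hamming_car, x * x = x;
  rang_itv : forall a : hamming_car, 0 <= rang a <= 1;
  rang_eq0 : forall a : hamming_car, rang a = 0 <-> a = 0;
  rang_eq1 : forall a : hamming_car, rang a = 1 <-> a = 1;
  rangD : forall a b : hamming_car, a * b = 0 -> rang (a + b) = rang a + rang b
}.

Definition hamming_iso (R : realType) (S T : hammingSpace R) : Prop :=
  exists f : {lrmorphism S -> T}, bijective f /\ forall x, rang (f x) = rang x.

(* The index is shifted: [cube n] has [n.+1] coordinates, so that it is never
   trivial. *)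
Definition cube (n : nat) : Type := {ffun 'I_n.+1 -> ('F_2)^o}.

HB.instance Definition _ n := GRing.PzRing.on (cube n).
HB.instance Definition _ n := GRing.Lmodule.on (cube n).

Section CubeInstances.
Variable n : nat.

Fact cube_mulC : commutative (@GRing.mul (cube n)).
Proof. by move=> x y; apply/ffunP=> i; rewrite !ffunE mulrC. Qed.

Fact cube_oner_neq0 : (1 : cube n) != 0.
Proof. exact: (ffun1_nonzero _ ord0). Qed.

HB.instance Definition _ :=
  GRing.PzSemiRing_isNonZero.Build (cube n) cube_oner_neq0.
HB.instance Definition _ :=
  GRing.PzRing_hasCommutativeMul.Build (cube n) cube_mulC.

Fact cube_scalerAl (a : 'F_2) (x y : cube n) : a *: (x * y) = (a *: x) * y.
Proof. by apply/ffunP=> i; rewrite !ffunE scalerAl. Qed.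

HB.instance Definition _ :=
  GRing.Lmodule_isLalgebra.Build 'F_2 (cube n) cube_scalerAl.
HB.instance Definition _ :=
  GRing.Lalgebra_isComAlgebra.Build 'F_2 (cube n).

End CubeInstances.

Section StandardHammingSpace.
Variables (R : realType) (n : nat).
Implicit Types x y : cube n.

Definition cube_rang x : R := (\sum_i (nat_of_ord (x i))%:R) / n.+1%:R.

Fact cube_idem x : x * x = x.
Proof.
apply/ffunP=> i; rewrite ffunE.
by case: (x i) => -[|[|//]] ?; apply: val_inj.
Qed.

Let n1_neq0 : n.+1%:R != 0 :> R. Proof. by rewrite pnatr_eq0. Qed.

Fact cube_rang_itv x : 0 <= cube_rang x <= 1.
Proof.
rewrite divr_ge0 ?sumr_ge0 ?ler0n //= ler_pdivrMr ?ltr0n // mul1r.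
rewrite -natr_sum ler_nat -[leqRHS]card_ord -sum1_card.
by apply: leq_sum => i _; case: (x i) => -[|[|//]].
Qed.

Fact cube_rang_eq0 x : cube_rang x = 0 <-> x = 0.
Proof.
split=> [/eqP|->]; last first.
  by rewrite /cube_rang big1 ?mul0r // => i _; rewrite ffunE.
rewrite mulf_eq0 invr_eq0 (negPf n1_neq0) orbF psumr_eq0 // => /allP xE.
apply/ffunP=> i; have := xE i (mem_index_enum i).
by rewrite ffunE /= pnatr_eq0 => /eqP xi0; apply: val_inj.
Qed.

Fact cube_rangD x y : x * y = 0 -> cube_rang (x + y) = cube_rang x + cube_rang y.
Proof.
move=> /ffunP xy0; rewrite /cube_rang -mulrDl -big_split /=; congr (_ / _).
apply: eq_bigr => i _; have := xy0 i; rewrite !ffunE -natrD.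
by case: (x i) (y i) => -[|[|//]] ? [[|[|//]]] ?.
Qed.

Fact cube_rang_eq1 x : cube_rang x = 1 <-> x = 1.
Proof.
have r1 : cube_rang 1 = 1.
  rewrite /cube_rang (eq_bigr (fun=> 1)) => [|i _]; last by rewrite ffunE.
  by rewrite sumr_const card_ord divff.
split=> [rx|->//].
have F22 (a : cube n) : a + a = 0.
  by apply/ffunP=> i; rewrite !ffunE; case: (a i) => -[|[|//]] ?; apply: val_inj.
have : cube_rang (x + 1) = 0.
  have := @cube_rangD x (x + 1); rewrite mulrDr mulr1 cube_idem F22 addrA F22.
  rewrite add0r r1 rx => /(_ erefl) e.
  by apply: (addrI 1); rewrite addr0 -e.
move=> /cube_rang_eq0 x1; rewrite -[x]addr0 -[in LHS](F22 1) addrA x1.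
by rewrite add0r.
Qed.

Definition standard_hamming : hammingSpace R :=
  HammingSpace cube_idem cube_rang_itv cube_rang_eq0 cube_rang_eq1 cube_rangD.

End StandardHammingSpace.

(* [T] is a subspace of [S], with the restricted rang, isomorphic to [S0]. *)
Definition hamming_subspace_iso (R : realType) (S S0 : hammingSpace R)
    (T : set S) : Prop :=
  GRing.subalg_closed [in T] /\
  exists f : {lrmorphism S0 -> S},
    [/\ injective f, range f = T & forall x, rang (f x) = rang x].

Definition locally_standard (R : realType) (S : hammingSpace R) : Prop :=
  forall s : seq S, exists (n : nat) (T : set S),
    hamming_subspace_iso (standard_hamming R n) T /\ forall x, x \in s -> T x.

(* The exponent of each prime; [None] stands for infinity. *)
Definition steinitz : Type := {p : nat | prime p} -> option nat.

(* Supremum in [nat] extended by infinity; the least upper bound when there is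
   one, infinity otherwise. *)
Definition nat_sup (E : set nat) : option nat :=
  match pselect (exists m, `[< ubound E m >]) with
  | left Ebounded => Some (ex_minn Ebounded)
  | right _ => None
  end.

Definition steinitz_lcm (X : set nat) : steinitz :=
  fun p => nat_sup [set logn (sval p) n | n in X].

Definition st_hamming (R : realType) (S : hammingSpace R) : steinitz :=
  steinitz_lcm [set n.+1 | n in
    [set n | exists T : set S, hamming_subspace_iso (standard_hamming R n) T]].

(* [B] is a subalgebra of [A] containing 1 and isomorphic to [A0]. *)
Definition subalgebra_iso (F : fieldType) (A A0 : algType F) (B : set A) : Prop :=
  GRing.subalg_closed [in B] /\
  exists f : {lrmorphism A0 -> A}, injective f /\ range f = B.

Definition alg_iso (F : fieldType) (A B : algType F) : Prop :=
  exists f : {lrmorphism A -> B}, bijective f.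

Definition locally_matrix (F : fieldType) (A : algType F) : Prop :=
  forall s : seq A, exists (n : nat) (B : set A),
    subalgebra_iso 'M[F]_n.+1 B /\ forall a, a \in s -> B a.

Definition st_alg (F : fieldType) (A : algType F) : steinitz :=
  steinitz_lcm [set n.+1 | n in
    [set n | exists B : set A, subalgebra_iso 'M[F]_n.+1 B]].

Definition countably_infinite_dim (F : fieldType) (V : lmodType F) : Prop :=
  exists b : nat -> V,
    (forall n (c : 'I_n -> F), \sum_(i < n) c i *: b i = 0 -> forall i, c i = 0) /\
    (forall v, exists n (c : 'I_n -> F), v = \sum_(i < n) c i *: b i).

Section RelativeRang.
Variables (F : fieldType) (R : realType) (A : algType F).

(* The rank is computed in the matrix subalgebra [range f] of [A]; see
   [relative_rangE] for the independence of the choice of [f]. *)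
Definition relative_rang (a : A) : R :=
  xget 0 [set q | exists (n : nat) (f : {lrmorphism 'M[F]_n.+1 -> A}) M,
    [/\ injective f, f M = a & q = (\rank M)%:R / n.+1%:R]].

End RelativeRang.
Arguments relative_rang {F} R {A}.

Section RankEmbedding.
Variable F : fieldType.

Lemma mxrank_orthoD n (P Q : 'M[F]_n.+1) :
  P * P = P -> Q * Q = Q -> P * Q = 0 -> Q * P = 0 ->
  (\rank (P + Q)%R = \rank P + \rank Q)%N.
Proof.
move=> PP QQ PQ QP; apply/eqP; rewrite eqn_leq mxrank_add /=.
rewrite -mxrank_disjoint_sum.
  apply: mxrankS; rewrite addsmx_sub; apply/andP; split; apply/submxP.
    by exists P; rewrite mulmxE mulrDr PP PQ addr0.
  by exists Q; rewrite mulmxE mulrDr QP QQ add0r.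
apply/eqP; rewrite -submx0; apply/rV_subP => v.
rewrite sub_capmx => /andP[/submxP[D vP] /submxP[E vQ]].
have vPE : v *m P = v by rewrite vP -mulmxA -/(P * P) PP.
by rewrite -vPE vQ -mulmxA -/(Q * P) QP mulmx0 sub0mx.
Qed.

Lemma mxrank_embed n m (f : {lrmorphism 'M[F]_n.+1 -> 'M[F]_m.+1})
    (M : 'M[F]_n.+1) :
  (\rank (f M) * n.+1 = \rank M * m.+1)%N.
Proof.
pose d (i j : 'I_n.+1) : 'M[F]_n.+1 := delta_mx i j.
have dd i j k l : d i j * d k l = if j == k then d i l else 0.
  rewrite /d -mulmxE; case: eqP => [->|/eqP jk]; first by rewrite mul_delta_mx.
  by rewrite mul_delta_mx_0.
pose c := \rank (f (d ord0 ord0)).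
have rd i : \rank (f (d i i)) = c.
  have le (j k : 'I_n.+1) : (\rank (f (d j j)) <= \rank (f (d k k)))%N.
    have -> : d j j = d j k * d k k * d k j by rewrite !dd !eqxx dd eqxx.
    rewrite !rmorphM /= -!mulmxE; apply: leq_trans (mxrankM_maxl _ _) _.
    exact: mxrankM_maxr.
  by apply/eqP; rewrite eqn_leq !le.
have rpid r : (r <= n.+1)%N -> \rank (f (pid_mx r)) = (r * c)%N.
  elim: r => [|r IH] rn; first by rewrite pid_mx_0 raddf0 mxrank0.
  have pidS : pid_mx r.+1 = pid_mx r + d (Ordinal rn) (Ordinal rn) :> 'M[F]_n.+1.
    apply/matrixP=> i j; rewrite !mxE -!val_eqE /= ltnS leq_eqVlt.
    case: eqP => [ij|ij].
      rewrite -ij andbb; case: ltngtP => // _; by rewrite ?addr0 ?add0r.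
    case: eqP => [ir|_] /=; last by rewrite addr0.
    by case: eqP => [jr|_]; [case: ij; rewrite ir jr|rewrite addr0].
  have pd : pid_mx r * d (Ordinal rn) (Ordinal rn) = 0 :> 'M[F]_n.+1.
    apply/matrixP=> i j; rewrite -mulmxE !mxE big1 // => k _; rewrite !mxE -!val_eqE /=.
    case: (k =P r :> nat) => [->|]; last by rewrite mulr0.
    by case: eqP => [->|]; rewrite ?ltnn ?mul0r.
  have dp : d (Ordinal rn) (Ordinal rn) * pid_mx r = 0 :> 'M[F]_n.+1.
    apply/matrixP=> i j; rewrite -mulmxE !mxE big1 // => k _; rewrite !mxE -!val_eqE /=.
    case: (k =P r :> nat) => [->|]; last by rewrite andbF mul0r.
    by rewrite ltnn andbF mulr0.
  rewrite pidS raddfD /= mxrank_orthoD ?IH ?rd; first by rewrite mulSn addnC.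
  - exact: ltnW.
  - by rewrite -rmorphM -mulmxE pid_mx_id //= ltnW.
  - by rewrite -rmorphM dd eqxx.
  - by rewrite -rmorphM pd raddf0.
  - by rewrite -rmorphM dp raddf0.
have mE : m.+1 = (n.+1 * c)%N.
  by rewrite -rpid // pid_mx_1 -[1%:M]/(1 : 'M[F]_n.+1) rmorph1 mxrank1.
have unitf (U : 'M[F]_n.+1) : U \in unitmx -> f U \in unitmx.
  by move=> Uu; have := rmorph_unit f (Uu : U \is a GRing.unit).
have -> : \rank (f M) = \rank (f (pid_mx (\rank M))).
  rewrite -[in LHS](mulmx_ebase M) mulmxE -/(_ * _ * _) !rmorphM /= -!mulmxE.
  rewrite mxrankMfree ?row_free_unit ?unitf ?row_ebase_unit//.
  by rewrite eqmxMfull // row_full_unit unitf // col_ebase_unit.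
by rewrite rpid ?rank_leq_row // mE -mulnA (mulnC c).
Qed.

End RankEmbedding.

Section RelativeRangTheory.
Variables (F : fieldType) (A : algType F).
Hypothesis Alm : locally_matrix A.

Let delta_seq n (f : 'M[F]_n.+1 -> A) :=
  [seq f (delta_mx p.1 p.2) | p <- enum [set: 'I_n.+1 * 'I_n.+1]%SET].

Let delta_seqP n (f : 'M[F]_n.+1 -> A) i j :
  f (delta_mx i j) \in delta_seq f.
Proof. by apply/mapP; exists (i, j); rewrite // mem_enum inE. Qed.

Lemma factor_embed n m (f : {lrmorphism 'M[F]_n.+1 -> A})
    (g : {lrmorphism 'M[F]_m.+1 -> A}) :
  injective g -> (forall x, x \in delta_seq f -> range g x) ->
  exists h : {lrmorphism 'M[F]_n.+1 -> 'M[F]_m.+1}, forall x, g (h x) = f x.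
Proof.
move=> ginj fg.
have /choice[h hE] x : exists y, g y = f x.
  have /choice[k kE] (p : 'I_n.+1 * 'I_n.+1) : exists y, g y = f (delta_mx p.1 p.2).
    by case: p => i j; have [y _ <-] := fg _ (delta_seqP f i j); exists y.
  exists (\sum_i \sum_j x i j *: k (i, j)).
  rewrite [in RHS](matrix_sum_delta x) !linear_sum; apply: eq_bigr => i _.
  by rewrite !linear_sum; apply: eq_bigr => j _; rewrite !linearZ_LR; congr (_ *: _); exact: (kE (i, j)).
have hlin : linear h.
  by move=> a x y; apply: ginj; rewrite hE [LHS]linearP [RHS]linearP; congr (_ *: _ + _); exact: esym (hE _).
have hmul : monoid_morphism h.
  by split=> [|x y]; apply: ginj; rewrite ?rmorphM hE ?rmorph1 ?rmorphM /= ?hE.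
pose hl := GRing.isLinear.Build F 'M[F]_n.+1 'M[F]_m.+1 *:%R h hlin.
pose hm := GRing.isMonoidMorphism.Build 'M[F]_n.+1 'M[F]_m.+1 h hmul.
pose H : {lrmorphism 'M[F]_n.+1 -> 'M[F]_m.+1} := HB.pack h hl hm.
by exists H.
Qed.

Lemma relative_rangE (R : realType) n (f : {lrmorphism 'M[F]_n.+1 -> A})
    (M : 'M[F]_n.+1) :
  injective f -> relative_rang R (f M) = (\rank M)%:R / n.+1%:R.
Proof.
move=> finj; rewrite /relative_rang; case: xgetP => [q _ /= [m [g [N]]]|]; last first.
  by move=> /(_ ((\rank M)%:R / n.+1%:R)) /=; case; exists n, f, M.
case=> ginj gN ->.
have [k [B [[_ [p [pinj pB]]] inB]]] := Alm (delta_seq f ++ delta_seq g).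
have [|h hE] := @factor_embed _ _ f p pinj.
  by move=> x xs; rewrite pB; apply: inB; rewrite mem_cat xs.
have [|l lE] := @factor_embed _ _ g p pinj.
  by move=> x xs; rewrite pB; apply: inB; rewrite mem_cat xs orbT.
have hl : h M = l N by apply: pinj; rewrite hE lE.
have := mxrank_embed h M; have := mxrank_embed l N; rewrite -hl => eN eM.
have k0 : (k.+1%:R : R) != 0 by rewrite pnatr_eq0.
apply/eqP; rewrite eqr_div ?pnatr_eq0 // -!natrM eqr_nat.
rewrite -(eqn_pmul2r (ltn0Sn k)) mulnAC -eN mulnAC [X in _ == X]mulnAC -eM.
by apply/eqP; rewrite mulnAC.
Qed.

End RelativeRangTheory.

Definition comm_subalgebra (F : fieldType) (A : algType F) (C : set A) : Prop :=
  GRing.subalg_closed [in C] /\ forall x y, C x -> C y -> x * y = y * x.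

Definition idempotents (F : fieldType) (A : algType F) (C : set A)
  & comm_subalgebra C : Type := set_type [set e | C e /\ e * e = e].

HB.instance Definition _ F A C (hC : @comm_subalgebra F A C) :=
  Choice.on (idempotents hC).

Section Idempotents.
Variables (F : fieldType) (A : algType F) (C : set A) (hC : comm_subalgebra C).
Implicit Types e f g : idempotents hC.

Definition idem_val e : A := val e.
Notation v := idem_val.

Fact idem_val_inj : injective v. Proof. exact: val_inj. Qed.

Let inC e : C (v e). Proof. by case: (set_mem (valP e)). Qed.
Let vv e : v e * v e = v e. Proof. by case: (set_mem (valP e)). Qed.
Let vC e f : v e * v f = v f * v e. Proof. exact: hC.2. Qed.

Let Clin a x y : C x -> C y -> C (a *: x + y).
Proof. by move=> Cx Cy; apply/set_mem; case: hC.1 => _ + _; apply; apply/mem_set. Qed.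
Let C1 : C 1. Proof. by apply/set_mem; case: hC.1. Qed.
Let C0 : C 0. Proof. by have := Clin (-1) C1 C1; rewrite scaleN1r addNr. Qed.
Let CM x y : C x -> C y -> C (x * y).
Proof. by move=> Cx Cy; apply/set_mem; case: hC.1 => _ _; apply; apply/mem_set. Qed.
Let CD x y : C x -> C y -> C (x + y).
Proof. by move=> Cx Cy; rewrite -[x]scale1r; apply: Clin. Qed.
Let CB x y : C x -> C y -> C (x - y).
Proof. by move=> Cx Cy; rewrite addrC -scaleN1r; apply: Clin. Qed.

Definition mk_idem x (Cx : C x) (xx : x * x = x) : idempotents hC :=
  exist _ x (mem_set (conj Cx xx)).

Definition bool_sum (x y : A) : A := x + y - (x * y) *+ 2.

Fact idem_add_subproof e f :
  bool_sum (v e) (v f) * bool_sum (v e) (v f) = bool_sum (v e) (v f).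
Proof.
rewrite /bool_sum; set x := v e; set y := v f.
have xx : x * x = x by exact: vv.
have yy : y * y = y by exact: vv.
have yx : y * x = x * y by exact: vC.
have xxy : x * (x * y) = x * y by rewrite mulrA xx.
have yxy : y * (x * y) = x * y by rewrite mulrA yx -mulrA yy.
have xyx : x * y * x = x * y by rewrite -mulrA yx xxy.
have xyy : x * y * y = x * y by rewrite -mulrA yy.
have xd : x * (x + y - (x * y) *+ 2) = x - x * y.
  by rewrite mulrBr mulrDr mulrnAr xx xxy mulr2n opprD addrACA subrr addr0.
have yd : y * (x + y - (x * y) *+ 2) = y - x * y.
  by rewrite mulrBr mulrDr mulrnAr yy yx yxy mulr2n opprD addrACA subrr add0r.
have zd : x * y * (x + y - (x * y) *+ 2) = 0.
  by rewrite -mulrA yd mulrBr xxy subrr.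
rewrite [LHS]mulrBl mulrDl xd yd mulrnAl zd mul0rn subr0.
by rewrite addrACA mulr2n opprD.
Qed.

Definition idem_zero : idempotents hC := mk_idem C0 (mulr0 0).
Definition idem_one : idempotents hC := mk_idem C1 (mulr1 1).
Definition idem_add e f : idempotents hC :=
  mk_idem (CB (CD (inC e) (inC f))
              (CD (CM (inC e) (inC f)) (CM (inC e) (inC f))))
          (idem_add_subproof e f).

Fact idem_mul_subproof e f : v e * v f * (v e * v f) = v e * v f.
Proof. by rewrite mulrA -[_ * v e]mulrA (vC f) mulrA vv -mulrA vv. Qed.

Definition idem_mul e f : idempotents hC :=
  mk_idem (CM (inC e) (inC f)) (idem_mul_subproof e f).

Fact idem_addA : associative idem_add.
Proof.
move=> e f g; apply: idem_val_inj => /=; rewrite [LHS]/= [RHS]/=.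
have E e' f' : v (idem_add e' f') = v e' + v f' - (v e' * v f') *+ 2 by [].
rewrite !E; set x := v e; set y := v f; set z := v g.
rewrite mulrBr mulrDr mulrnAr mulrBl mulrDl mulrnAl mulrA.
set p := x * y; set r := x * z; set q := y * z; set t := p * z.
rewrite !mulrnBl !mulrnDl !opprB !opprD !addrA.
by rewrite [LHS](ACl (1*2*10*11*3*6*7*8*9*12*13*4*5)).
Qed.

Fact idem_addC : commutative idem_add.
Proof.
move=> e f; apply: idem_val_inj; rewrite [LHS]/= [RHS]/=.
by rewrite /idem_val /= /bool_sum vC [X in X - _]addrC.
Qed.

Fact idem_add0 : left_id idem_zero idem_add.
Proof.
move=> e; apply: idem_val_inj; change (0 + v e - (0 * v e) *+ 2 = v e).
by rewrite mul0r mul0rn subr0 add0r.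
Qed.

Fact idem_addN : left_inverse idem_zero id idem_add.
Proof.
move=> e; apply: idem_val_inj; change (v e + v e - (v e * v e) *+ 2 = 0).
by rewrite vv mulr2n subrr.
Qed.

HB.instance Definition _ :=
  GRing.isZmodule.Build (idempotents hC) idem_addA idem_addC idem_add0 idem_addN.

Fact idem_mulA : associative idem_mul.
Proof. by move=> e f g; apply: val_inj; rewrite /= /idem_val/= mulrA. Qed.

Fact idem_mulC : commutative idem_mul.
Proof. by move=> e f; apply: val_inj; rewrite /= vC. Qed.

Fact idem_mul1 : left_id idem_one idem_mul.
Proof. by move=> e; apply: val_inj; rewrite /= /idem_val/= mul1r. Qed.

Fact idem_mulDl : left_distributive idem_mul idem_add.
Proof.
move=> e f g; apply: idem_val_inj.
change ((v e + v f - (v e * v f) *+ 2) * v g =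
        v e * v g + v f * v g - (v e * v g * (v f * v g)) *+ 2).
rewrite mulrBl mulrDl mulrnAl.
congr (_ - _ *+ 2); rewrite -[LHS]mulrA -[RHS]mulrA; congr (_ * _).
by rewrite mulrA (vC g) -mulrA vv.
Qed.

Fact idem_oner_neq0 : idem_one != idem_zero.
Proof. by apply/eqP => /(congr1 idem_val) /eqP; rewrite oner_eq0. Qed.

HB.instance Definition _ :=
  GRing.Zmodule_isComNzRing.Build (idempotents hC)
    idem_mulA idem_mulC idem_mul1 idem_mulDl idem_oner_neq0.

(* A Boolean ring is an ['F_2]-algebra in a unique way. *)
Definition idem_scale (a : 'F_2) e : idempotents hC := e *+ a.

Let mul2 e : e *+ 2 = 0. Proof. by rewrite mulr2n -[X in X + _]opprK; exact: addNr. Qed.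

Let mulmod2 e k : e *+ (k %% 2) = e *+ k.
Proof. by rewrite [in RHS](divn_eq k 2) mulrnDr mulnC mulrnA mul2 mul0rn add0r. Qed.

Fact idem_scalerA a b e : idem_scale a (idem_scale b e) = idem_scale (a * b) e.
Proof. by rewrite /idem_scale -mulrnA [RHS]mulmod2 mulnC. Qed.
Fact idem_scale1r : left_id 1 idem_scale. Proof. by []. Qed.
Fact idem_scalerDr : right_distributive idem_scale +%R.
Proof. by move=> a e f; rewrite /idem_scale mulrnDl. Qed.
Fact idem_scalerDl e : {morph idem_scale^~ e : a b / a + b}.
Proof. by move=> a b; rewrite /idem_scale [LHS]mulmod2 mulrnDr. Qed.

HB.instance Definition _ :=
  GRing.Zmodule_isLmodule.Build 'F_2 (idempotents hC)
    idem_scalerA idem_scale1r idem_scalerDr idem_scalerDl.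

Fact idem_scalerAl (a : 'F_2) e f : a *: (e * f) = (a *: e) * f.
Proof. by rewrite /GRing.scale /= /idem_scale mulrnAl. Qed.

HB.instance Definition _ :=
  GRing.Lmodule_isLalgebra.Build 'F_2 (idempotents hC) idem_scalerAl.
HB.instance Definition _ :=
  GRing.Lalgebra_isComAlgebra.Build 'F_2 (idempotents hC).

Lemma idem_valD e f : v (e + f) = v e + v f - (v e * v f) *+ 2. Proof. by []. Qed.
Lemma idem_valM e f : v (e * f) = v e * v f. Proof. by []. Qed.

Fact idem_idem e : e * e = e.
Proof. by apply: idem_val_inj; rewrite idem_valM vv. Qed.

Section Rang.
Variables (R : realType) (Alm : locally_matrix A).

Definition idem_rang e : R := relative_rang R (v e).

Let common_mx e f : exists n (h : {lrmorphism 'M[F]_n.+1 -> A}) M N,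
  [/\ injective h, v e = h M & v f = h N].
Proof.
have [n [B [[_ [h [hinj hB]]] inB]]] := Alm [:: v e; v f].
have [M _ hM] : range h (v e) by rewrite hB; apply: inB; rewrite mem_head.
have [N _ hN] : range h (v f) by rewrite hB; apply: inB; rewrite mem_behead ?mem_head.
by exists n, h, M, N.
Qed.

Fact idem_rang_itv e : 0 <= idem_rang e <= 1.
Proof.
have [n [h [M [_ [hinj eM _]]]]] := common_mx e e.
rewrite /idem_rang eM relative_rangE // divr_ge0 ?ler0n //=.
by rewrite ler_pdivrMr ?ltr0n // mul1r ler_nat rank_leq_row.
Qed.

Fact idem_rang_eq0 e : idem_rang e = 0 <-> e = 0.
Proof.
have [n [h [M [_ [hinj eM _]]]]] := common_mx e e.
rewrite /idem_rang eM relative_rangE //; split=> [/eqP|e0].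
  rewrite mulf_eq0 invr_eq0 !pnatr_eq0 orbF mxrank_eq0 => /eqP M0.
  by apply: idem_val_inj; rewrite eM M0 raddf0.
have -> : M = 0 by apply: hinj; rewrite -eM e0 raddf0.
by rewrite mxrank0 mul0r.
Qed.

Fact idem_rang_eq1 e : idem_rang e = 1 <-> e = 1.
Proof.
have [n [h [M [_ [hinj eM _]]]]] := common_mx e e.
have n0 : n.+1%:R != 0 :> R by rewrite pnatr_eq0.
rewrite /idem_rang eM relative_rangE //; split=> [/(canRL (divfK n0))|e1].
  rewrite mul1r => /eqP; rewrite eqr_nat => rM.
  have uM : M \is a GRing.unit by rewrite -[_ \is a _]row_free_unit /row_free rM.
  have MM : M * M = M by apply: hinj; rewrite rmorphM /= -eM vv.
  have M1 : M = 1 by apply: (mulrI uM); rewrite MM mulr1.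
  by apply: idem_val_inj; rewrite eM M1 rmorph1.
have -> : M = 1 by apply: hinj; rewrite -eM e1 rmorph1.
by rewrite mxrank1 divff.
Qed.

Fact idem_rangD e f : e * f = 0 -> idem_rang (e + f) = idem_rang e + idem_rang f.
Proof.
move=> /(congr1 idem_val); rewrite idem_valM => ef0.
have [n [h [M [N [hinj eM fN]]]]] := common_mx e f.
rewrite /idem_rang idem_valD ef0 mul0rn subr0 eM fN -raddfD.
rewrite !relative_rangE // -mulrDl -natrD mxrank_orthoD //.
- by apply: hinj; rewrite rmorphM /= -eM vv.
- by apply: hinj; rewrite rmorphM /= -fN vv.
- by apply: hinj; rewrite rmorphM /= -eM -fN ef0 raddf0.
- by apply: hinj; rewrite rmorphM /= -eM -fN vC ef0 raddf0.
Qed.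

Definition idempotent_space : hammingSpace R :=
  HammingSpace idem_idem idem_rang_itv idem_rang_eq0 idem_rang_eq1 idem_rangD.

End Rang.
End Idempotents.

Arguments idempotent_space {F A C} hC R Alm.

Section TensorProduct.
Variables (F : fieldType) (V : lmodType F) (k : nat) (B : 'I_k -> set V).

Definition multilinear_on (W : lmodType F) (g : ('I_k -> V) -> W) : Prop :=
  forall (b : 'I_k -> V) (i : 'I_k) (a : F) (x y : V),
    (forall j, B j (b j)) -> B i x -> B i y ->
    g [eta b with i |-> a *: x + y] =
      a *: g [eta b with i |-> x] + g [eta b with i |-> y].

(* The tensor product of subspaces [B 0], ..., [B k.-1] of [V]: the pure
   tensors are the values of [tensor] on the families [b] with [b i] in [B i]
   for all [i]; its values on other families are irrelevant. *)
Record tensorProduct := TensorProduct {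
  tensor_car :> lmodType F;
  tensor : ('I_k -> V) -> tensor_car;
  tensor_multilinear : multilinear_on tensor;
  tensor_universal : forall (W : lmodType F) (g : ('I_k -> V) -> W),
    multilinear_on g ->
    exists h : {linear tensor_car -> W},
      (forall b, (forall i, B i (b i)) -> h (tensor b) = g b) /\
      forall h' : {linear tensor_car -> W},
        (forall b, (forall i, B i (b i)) -> h' (tensor b) = g b) -> h' =1 h
}.

End TensorProduct.

Section Cartan.
Variables (F : fieldType) (A : algType F).

(* [A] is the tensor product of its subalgebras [B i], of matrix size
   [(n i).+1]; [mu k] is the multiplication map from the tensor product of
   [B 0], ..., [B k] to [A]. *)
Definition matrix_decomposition (n : nat -> nat) (B : nat -> set A) : Prop :=
  [/\ forall i, subalgebra_iso 'M[F]_((n i).+1) (B i),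
      forall i j, i != j -> forall x y, B i x -> B j y -> x * y = y * x &
      exists (T : forall k, tensorProduct (fun i : 'I_k.+1 => B i))
             (mu : forall k, {linear T k -> A}),
        [/\ forall k (b : 'I_k.+1 -> A), (forall i : 'I_k.+1, B i (b i)) ->
              mu k (tensor (T k) b) = \prod_(i < k.+1) b i,
            forall k, injective (mu k) &
            forall a, exists k, range (mu k) a]].

(* [C] is a Cartan subalgebra of [B], where [B] is isomorphic to the algebra of
   matrices of size [n]. *)
Definition matrix_cartan (n : nat) (B C : set A) : Prop :=
  exists e : 'I_n -> A,
    [/\ forall i, B (e i),
        forall i, e i != 0,
        forall i, e i * e i = e i,
        forall i j, i != j -> e i * e j = 0 &
        C = range (fun c : 'I_n -> F => \sum_(i < n) c i *: e i)].

Definition generated_subalgebra (X : set A) : set A :=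
  smallest (fun D : set A => GRing.subalg_closed [in D]) X.

Definition cartan_subalgebra (H : set A) : Prop :=
  exists (n : nat -> nat) (B C : nat -> set A),
    [/\ matrix_decomposition n B,
        forall i, matrix_cartan (n i).+1 (B i) (C i) &
        H = generated_subalgebra (\bigcup_i C i)].

Lemma generated_subalg_closed (X : set A) :
  GRing.subalg_closed [in generated_subalgebra X].
Proof.
have sub D : GRing.subalg_closed [in D] -> X `<=` D ->
    generated_subalgebra X `<=` D by exact: smallest_sub.
split=> [|a x y|x y].
- by apply/mem_set => D [[D1 _ _] _]; apply: set_mem.
- move=> /set_mem gx /set_mem gy; apply/mem_set => D [Dc XD].
  by apply: set_mem; case: (Dc) => _ lin _; apply: lin; apply/mem_set; apply: sub.
- move=> /set_mem gx /set_mem gy; apply/mem_set => D [Dc XD].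
  by apply: set_mem; case: (Dc) => _ _ mul; apply: mul; apply/mem_set; apply: sub.
Qed.

Lemma generated_comm (X : set A) :
  (forall x y, X x -> X y -> x * y = y * x) ->
  comm_subalgebra (generated_subalgebra X).
Proof.
move=> XC; split; first exact: generated_subalg_closed.
pose Z (Y : set A) := [set a | forall y, Y y -> a * y = y * a].
have Zc Y : GRing.subalg_closed [in Z Y].
  split=> [|a x y|x y].
  - by apply/mem_set => y _; rewrite mul1r mulr1.
  - move=> /set_mem Zx /set_mem Zy; apply/mem_set => z Yz.
    by rewrite mulrDl mulrDr -scalerAl -scalerAr Zx // Zy.
  - move=> /set_mem Zx /set_mem Zy; apply/mem_set => z Yz.
    by rewrite -mulrA Zy // mulrA Zx // mulrA.
have gX : generated_subalgebra X `<=` Z X.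
  by apply: smallest_sub => // x Xx y Xy; apply: XC.
have gg : generated_subalgebra X `<=` Z (generated_subalgebra X).
  by apply: smallest_sub => // x Xx y gy; exact: esym (gX _ gy _ Xx).
by move=> x y gx gy; apply: gg.
Qed.

Lemma cartan_comm (H : set A) : cartan_subalgebra H -> comm_subalgebra H.
Proof.
move=> [n [B [C [[iso Bcomm _] CB ->]]]]; apply: generated_comm.
have CsubB i : C i `<=` B i.
  have [[B1 Blin _] _] := iso i; have [e [eB _ _ _ ->]] := CB i.
  have B0 : (0 : A) \in B i.
    by have := Blin (-1) 1 1 B1 B1; rewrite scaleN1r addNr.
  move=> x [c _ <-]; apply: set_mem; elim/big_rec: _ => // k y _ By.
  by apply: Blin => //; apply/mem_set; apply: eB.
move=> x y [i _ Cx] [j _ Cy].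
have [ij|ij] := eqVneq i j; last by apply: Bcomm ij _ _ _ _; apply: CsubB.
move: Cy; rewrite -ij => Cy.
have [e [_ _ ee eo CE]] := CB i.
move: Cx Cy; rewrite CE => -[c _ <-] [d _ <-].
have mulE (c' d' : 'I_(n i).+1 -> F) :
    (\sum_k c' k *: e k) * (\sum_k d' k *: e k) = \sum_k (c' k * d' k) *: e k.
  rewrite mulr_suml; apply: eq_bigr => k _.
  rewrite mulr_sumr (bigD1 k) //= big1 ?addr0 => [|l lk].
    by rewrite -scalerAl -scalerAr ee scalerA.
  by rewrite -scalerAl -scalerAr eo 1?eq_sym // !scaler0.
by rewrite !mulE; apply: eq_bigr => k _; rewrite mulrC.
Qed.

End Cartan.

(* Main.v *)
(** Both structures are described by coherent systems of units.  Let [D] be a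
    directed, divisor-closed set of positive integers.  A matrix system in [A]
    consists of matrix units [u N i j] ([i, j < N]) for every [N] in [D], such
    that for [a %| b] the unit [u a i j] is the sum of the [u b (i + t a) (j + t a)]
    (the block-diagonal embedding), and whose spans exhaust [A]; a Hamming system
    consists of partitions of 1 into elements [x N i] of rang [1 / N] with the same
    coherence.  Having fixed the embeddings once and for all, two systems over the
    same [D] are isomorphic by sending units to units, so neither a back-and-forth
    argument nor the Skolem-Noether theorem is needed; and [D] is an invariant, as
    it consists of the sizes of the unital matrix subalgebras (standard subspaces).

    A Cartan subalgebra [H] gives a matrix system whose diagonal units span [H]:
    in each tensor factor, diagonalise the orthogonal idempotents, and multiply
    the resulting commuting units, indexed in mixed radix.  The diagonal units then
    form a Hamming system of [E(H)] over the same [D], whence (2).  For (1), [S]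
    is exhausted by successively refined partitions, hence has a Hamming system,
    and the corresponding [A] is built inside the linear operators on the
    functions on an infinite product of finite sets, the i-th tensor factor
    acting on the i-th coordinate. *)

Require Import Defs.
From HB Require Import structures.
From mathcomp Require Import all_boot all_order all_algebra.
From mathcomp Require Import mathcomp_extra boolp classical_sets functions.
From mathcomp Require Import cardinality reals.

Set Implicit Arguments.
Unset Strict Implicit.
Unset Printing Implicit Defensive.

Import Order.TTheory GRing.Theory Num.Theory.

Local Open Scope classical_set_scope.
Local Open Scope card_scope.
Local Open Scope ring_scope.

(** * Matrix units *)

(** Fixes the numbering used for all refinements: the residue modulo [N] is the position inside a
    block, and the quotient [t] is the number of the block. *)
Lemma sum_ord_mul (V : nmodType) (N q : nat) (f : nat -> V) :
  \sum_(i < N * q) f i = \sum_(i < N) \sum_(t < q) f (i + t * N)%N.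
Proof.
elim: q => [|q IH].
  by rewrite muln0 big_ord0 big1 // => i _; rewrite big_ord0.
rewrite mulnS addnC big_split_ord /= IH.
under [RHS]eq_bigr do rewrite big_ord_recr /=.
by rewrite big_split /=; congr (_ + _); apply: eq_bigr => i _; rewrite addnC mulnC.
Qed.

Lemma sum_ord_pred1 (V : nmodType) (N j : nat) (f : nat -> V) : (j < N)%N ->
  \sum_(i < N) (if i == j :> nat then f i else 0) = f j.
Proof.
move=> jN; rewrite (bigD1 (Ordinal jN)) //= eqxx big1 ?addr0 // => i.
by rewrite -val_eqE /= => /negPf->.
Qed.

Lemma divn_add_mul i t a : (i < a)%N -> ((i + t * a) %/ a)%N = t.
Proof. by move=> ia; rewrite addnC divnMDl ?divn_small ?addn0 //; case: a ia. Qed.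

Lemma modn_add_mul i t a : (i < a)%N -> ((i + t * a) %% a)%N = i.
Proof. by move=> ia; rewrite addnC modnMDl modn_small. Qed.

Lemma ltn_add_mul i t a q : (i < a)%N -> (t < q)%N -> (i + t * a < a * q)%N.
Proof.
move=> ia tq; rewrite (@leq_trans (t.+1 * a)) ?mulSn ?ltn_add2r //.
by rewrite -mulSn mulnC leq_pmul2l //; case: a ia.
Qed.

Section MatrixUnits.
Variables (F : fieldType) (A : algType F).
Implicit Types (N : nat) (u : nat -> nat -> A) (c : nat -> nat -> F).

(** Units and coefficients are indexed by [nat] rather than by ordinals, so that sizes related by
    divisibility can be compared without casts; only indices below [N] matter. *)
Definition mxunits N u : Prop :=
  (forall i j k l, (i < N)%N -> (j < N)%N -> (k < N)%N -> (l < N)%N ->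
     u i j * u k l = if j == k then u i l else 0) /\
  \sum_(i < N) u i i = 1.

Definition mxcomb N u c : A := \sum_(i < N) \sum_(j < N) c i j *: u i j.

Lemma eq_mxcomb N u c d :
  (forall i j, (i < N)%N -> (j < N)%N -> c i j = d i j) ->
  mxcomb N u c = mxcomb N u d.
Proof.
by move=> cd; apply: eq_bigr => i _; apply: eq_bigr => j _; rewrite cd.
Qed.

Lemma mxcomb_linear N u a c d :
  mxcomb N u (fun i j => a * c i j + d i j) = a *: mxcomb N u c + mxcomb N u d.
Proof.
rewrite /mxcomb scaler_sumr -big_split; apply: eq_bigr => i _ /=.
rewrite scaler_sumr -big_split; apply: eq_bigr => j _ /=.
by rewrite scalerDl scalerA.
Qed.

Lemma mxcomb_delta N u k l : (k < N)%N -> (l < N)%N ->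
  mxcomb N u (fun i j => ((i == k) && (j == l))%:R) = u k l.
Proof.
move=> kN lN; rewrite -[RHS](sum_ord_pred1 (u^~ l) kN); apply: eq_bigr => i _.
have [ik|ik] := eqVneq; last by rewrite big1 // => j _; rewrite scale0r.
rewrite -(sum_ord_pred1 (u i) lN); apply: eq_bigr => j _ /=.
by case: eqP => _; rewrite ?scale1r ?scale0r.
Qed.

Variables (N : nat) (u : nat -> nat -> A).
Hypothesis uu : mxunits N u.

Lemma mxunits_gt0 : (0 < N)%N.
Proof.
have [_] := uu; case: N => // /esym/eqP.
by rewrite big_ord0 oner_eq0.
Qed.

Lemma mxcomb_mul c d :
  mxcomb N u c * mxcomb N u d
    = mxcomb N u (fun i j => \sum_(k < N) c i k * d k j).
Proof.
rewrite /mxcomb mulr_suml; apply: eq_bigr => i _; rewrite mulr_suml.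
under eq_bigr => k _.
  rewrite mulr_sumr (bigD1 k) //= [X in _ + X]big1 ?addr0 => [|l lk]; last first.
    rewrite mulr_sumr big1 // => j _; rewrite -scalerAl -scalerAr uu.1 //.
    by rewrite ifN ?scaler0 // eq_sym.
  rewrite mulr_sumr; under eq_bigr do
    rewrite -scalerAl -scalerAr uu.1 // eqxx scalerA.
  over.
by rewrite exchange_big; apply: eq_bigr => j _; rewrite scaler_suml.
Qed.

Lemma mxcomb1 : mxcomb N u (fun i j => (i == j)%:R) = 1.
Proof.
rewrite -uu.2; apply: eq_bigr => i _.
rewrite -(sum_ord_pred1 (u i) (ltn_ord i)); apply: eq_bigr => j _.
by rewrite eq_sym; case: eqP => _; rewrite ?scale1r ?scale0r.
Qed.

(** A diagonal unit factors as [u k i * u i j * u j k], so if [u i j] vanished, all diagonal units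
    and their sum 1 would vanish. *)
Lemma mxunits_neq0 i j : (i < N)%N -> (j < N)%N -> u i j != 0.
Proof.
move=> iN jN; apply/eqP => uij0; have [_ /esym/eqP] := uu.
rewrite big1 ?oner_eq0 // => k _.
have <- : u k i * u i j * u j k = u k k by rewrite !uu.1 ?eqxx ?uu.1 ?eqxx.
by rewrite uij0 mulr0 mul0r.
Qed.

(** Sandwiching between two diagonal units isolates one coefficient; as the units are nonzero, this
    makes coefficients unique. *)
Lemma mxcomb_coef c i j : (i < N)%N -> (j < N)%N ->
  u i i * mxcomb N u c * u j j = c i j *: u i j.
Proof.
move=> iN jN; rewrite -(mxcomb_delta u iN iN) -(mxcomb_delta u jN jN) !mxcomb_mul.
have <- : mxcomb N u (fun k l => c i j * ((k == i) && (l == j))%:R)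
    = c i j *: u i j.
  rewrite -(mxcomb_delta u iN jN) -[RHS]addr0 -[X in _ + X](_ : mxcomb N u (fun _ _ => 0) = 0).
    by rewrite -mxcomb_linear; apply: eq_mxcomb => k l _ _; rewrite addr0.
  by apply: big1 => k _; apply: big1 => l _; rewrite scale0r.
apply: eq_mxcomb => k l kN lN.
rewrite (bigD1 (Ordinal jN)) //= [X in _ + X]big1 ?addr0 => [|s]; last first.
  by rewrite -val_eqE /= => /negPf->; rewrite mulr0.
rewrite eqxx (bigD1 (Ordinal iN)) //= big1 ?addr0 => [|s]; last first.
  by rewrite -val_eqE /= => /negPf->; rewrite andbF mul0r.
by rewrite eqxx andbT; case: (k == i); case: (l == j);
  rewrite ?(mul1r, mulr1, mulr0, mul0r).
Qed.

Lemma mxcomb_inj c d i j : mxcomb N u c = mxcomb N u d ->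
  (i < N)%N -> (j < N)%N -> c i j = d i j.
Proof.
move=> cd iN jN; apply/eqP; rewrite -subr_eq0.
have: (c i j - d i j) *: u i j == 0.
  by rewrite scalerBl -!mxcomb_coef // cd subrr.
by rewrite scaler_eq0 (negPf (mxunits_neq0 iN jN)) orbF.
Qed.

End MatrixUnits.

(** * Closure properties of subalgebras *)

Section SubalgebraClosed.
Variables (K : nzRingType) (A : algType K) (E : set A).
Hypothesis Ecl : GRing.subalg_closed [in E].

Lemma subalg_closed1 : E 1.
Proof. by apply: set_mem; case: Ecl. Qed.

Lemma subalg_closedP a x y : E x -> E y -> E (a *: x + y).
Proof. by move=> Ex Ey; apply: set_mem; case: Ecl => _ + _; apply; apply/mem_set. Qed.

Lemma subalg_closedM x y : E x -> E y -> E (x * y).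
Proof. by move=> Ex Ey; apply: set_mem; case: Ecl => _ _; apply; apply/mem_set. Qed.

Lemma subalg_closed0 : E 0.
Proof.
by have := subalg_closedP (-1) subalg_closed1 subalg_closed1; rewrite scaleN1r addNr.
Qed.

Lemma subalg_closed_comb m (c : 'I_m -> K) (f : 'I_m -> A) :
  (forall i, E (f i)) -> E (\sum_(i < m) c i *: f i).
Proof.
move=> Ef; elim/big_rec: _ => [|i x _ Ex]; first exact: subalg_closed0.
exact: subalg_closedP.
Qed.

Lemma subalg_closed_sum m (f : 'I_m -> A) :
  (forall i, E (f i)) -> E (\sum_(i < m) f i).
Proof.
by move=> /(subalg_closed_comb (fun=> 1)); under eq_bigr do rewrite scale1r.
Qed.

Lemma subalg_closed_prod m (f : 'I_m -> A) :
  (forall i, E (f i)) -> E (\prod_(i < m) f i).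
Proof.
move=> Ef; elim/big_ind: _ => //; first exact: subalg_closed1.
exact: subalg_closedM.
Qed.

End SubalgebraClosed.

Lemma lrmorphism_range_closed (K : nzRingType) (A B : algType K)
    (f : {lrmorphism A -> B}) : GRing.subalg_closed [in range f].
Proof.
split=> [|a x y|x y].
- by apply/mem_set; exists 1; rewrite ?rmorph1.
- move=> /set_mem[x' _ <-] /set_mem[y' _ <-]; apply/mem_set.
  by exists (a *: x' + y') => //; rewrite linearP.
- move=> /set_mem[x' _ <-] /set_mem[y' _ <-]; apply/mem_set.
  by exists (x' * y') => //; rewrite rmorphM.
Qed.

Lemma mxunits_morphism (F : fieldType) (A : algType F) n (u : nat -> nat -> A) :
  mxunits n.+1 u ->
  exists f : {lrmorphism 'M[F]_n.+1 -> A}, injective f /\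
    forall M, f M = \sum_(i < n.+1) \sum_(j < n.+1) M i j *: u i j.
Proof.
move=> uu; pose c (M : 'M[F]_n.+1) (i j : nat) := M (inord i) (inord j).
pose h (M : 'M[F]_n.+1) : A := mxcomb n.+1 u (c M).
have hlin : linear h.
  move=> a x y; rewrite /h -mxcomb_linear; apply: eq_mxcomb => i j _ _.
  by rewrite /c !mxE.
have hmul : monoid_morphism h.
  split=> [|x y]; rewrite /h.
    rewrite -(mxcomb1 uu); apply: eq_mxcomb => i j iN jN.
    by rewrite /c -[1]/(1%:M) !mxE -val_eqE /= !inordK.
  rewrite (mxcomb_mul uu); apply: eq_mxcomb => i j iN jN.
  by rewrite /c -mulmxE mxE; apply: eq_bigr => k _; rewrite inord_val.
pose hl := GRing.isLinear.Build F 'M[F]_n.+1 A *:%R h hlin.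
pose hm := GRing.isMonoidMorphism.Build 'M[F]_n.+1 A h hmul.
pose H : {lrmorphism 'M[F]_n.+1 -> A} := HB.pack h hl hm.
exists H; split=> [M P MP|M].
  apply/matrixP => i j.
  by have := mxcomb_inj uu MP (ltn_ord i) (ltn_ord j); rewrite /c !inord_val.
by apply: eq_bigr => i _; apply: eq_bigr => j _; rewrite /c !inord_val.
Qed.

(** * Coherent systems along divisibility *)

(* [u a i j] with [i] or [j] at least [a] is junk. *)
Definition coherent (V : nmodType) (D : set nat) (u : nat -> nat -> nat -> V) :=
  forall a b, D b -> (a %| b)%N -> forall i j, (i < a)%N -> (j < a)%N ->
    u a i j = \sum_(t < b %/ a) u b (i + t * a)%N (j + t * a)%N.

Definition divisors_of (p : nat -> nat) : set nat := [set a | exists k, (a %| p k)%N].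

(** Such sets are exactly the sets of positive divisors of Steinitz numbers, so [D] is a Steinitz
    number in disguise. *)
Definition dirset (D : set nat) : Prop :=
  [/\ exists N, D N, forall N, D N -> (0 < N)%N,
      forall a b, D a -> D b -> exists2 c, D c & (a %| c)%N /\ (b %| c)%N &
      forall a b, D b -> (a %| b)%N -> D a].

Section LinearCombinations.
Variables (K : nzRingType) (V : lmodType K).
Implicit Types (x : nat -> V) (c : nat -> K).

Definition lcomb (N : nat) x c : V := \sum_(i < N) c i *: x i.

Lemma eq_lcomb N x c d : (forall i, (i < N)%N -> c i = d i) ->
  lcomb N x c = lcomb N x d.
Proof. by move=> cd; apply: eq_bigr => i _; rewrite cd. Qed.

Lemma lcomb_linear N x a c d :
  lcomb N x (fun i => a * c i + d i) = a *: lcomb N x c + lcomb N x d.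
Proof.
rewrite /lcomb scaler_sumr -big_split; apply: eq_bigr => i _ /=.
by rewrite scalerDl scalerA.
Qed.

(** The coarse element [x a i] is the sum of the fine ones whose index is congruent to [i] modulo
    [a], so the coefficients repeat with period [a]. *)
Lemma lcomb_lift (D : set nat) (x : nat -> nat -> V) a b c :
  dirset D -> coherent D (fun N i _ => x N i) -> D b -> (a %| b)%N ->
  lcomb a (x a) c = lcomb b (x b) (fun i => c (i %% a)%N).
Proof.
move=> [_ Dpos _ _] coh Db ab; have /dvdnP[q bE] := ab.
have : (0 < b)%N by exact: Dpos.
rewrite {1}bE muln_gt0 => /andP[q0 a0].
pose f i := c (i %% a)%N *: x b i.
transitivity (\sum_(i < a * q) f i); last by rewrite mulnC -bE.
rewrite sum_ord_mul; apply: eq_bigr => i _.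
rewrite (coh _ _ Db ab i i) // scaler_sumr bE mulnK //; apply: eq_bigr => t _.
by rewrite /f modn_add_mul // bE.
Qed.

End LinearCombinations.

Lemma lcomb_mul (K : nzRingType) (A : algType K) (N : nat) (x : nat -> A) c d :
  (forall i j, (i < N)%N -> (j < N)%N -> x i * x j = if i == j then x i else 0) ->
  lcomb N x c * lcomb N x d = lcomb N x (fun i => c i * d i).
Proof.
move=> xx; rewrite /lcomb mulr_suml; apply: eq_bigr => i _.
rewrite -scalerAl mulr_sumr (bigD1 i) //= big1 ?addr0 => [|j ji].
  by rewrite -scalerAr xx // eqxx scalerA.
by rewrite -scalerAr xx // ifN ?scaler0 // eq_sym.
Qed.

(** * Extension of a chain of units to all divisors *)

Section Coarsening.
Variables (V : nmodType) (p : nat -> nat) (v : nat -> nat -> nat -> V).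
Hypothesis p_gt0 : forall k, (0 < p k)%N.
Hypothesis p_dvd : forall k, (p k %| p k.+1)%N.
Hypothesis v_coh : forall k i j, (i < p k)%N -> (j < p k)%N ->
  v k i j = \sum_(t < p k.+1 %/ p k) v k.+1 (i + t * p k)%N (j + t * p k)%N.

(** What the units of size [a] must be if they are to be coherent with level [k]. *)
Definition coarse k a i j : V :=
  \sum_(t < p k %/ a) v k (i + t * a)%N (j + t * a)%N.

Lemma chain_dvd k l : (k <= l)%N -> (p k %| p l)%N.
Proof.
move=> /subnKC <-; elim: (l - k)%N => [|d IH]; first by rewrite addn0.
by rewrite addnS; apply: dvdn_trans (p_dvd _).
Qed.

Lemma dirset_divisors_of : dirset (divisors_of p).
Proof.
split=> [|N [k]|a b [k ak] [l bl]|a b [k bk] ab].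
- by exists (p 0); exists 0%N.
- by move/dvdn_gt0; apply.
- exists (p (maxn k l)); first by exists (maxn k l).
  by split; [apply: dvdn_trans ak _|apply: dvdn_trans bl _];
    apply: chain_dvd; rewrite ?leq_maxl ?leq_maxr.
- by exists k; apply: dvdn_trans bk.
Qed.

(** Writing a block number as [t + s * (b %/ a)] groups the blocks of size [a] inside the blocks of
    size [b]. *)
Lemma coarse_refine k a b i j : (a %| b)%N -> (b %| p k)%N ->
  coarse k a i j = \sum_(t < b %/ a) coarse k b (i + t * a)%N (j + t * a)%N.
Proof.
move=> /dvdnP[q ->] /dvdnP[r pk].
have : (0 < r * (q * a))%N by rewrite -pk.
rewrite !muln_gt0 => /and3P[r0 q0 a0].
have coarseE c s i' j' : (0 < c)%N -> p k = (s * c)%N ->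
    coarse k c i' j' = \sum_(t < s) v k (i' + t * c)%N (j' + t * c)%N.
  by move=> c0 pkE; rewrite /coarse pkE mulnK.
under [RHS]eq_bigr do rewrite (coarseE _ r) ?muln_gt0 ?q0 //.
rewrite (coarseE _ (q * r)%N) ?pk //; last by rewrite mulnCA mulnA.
rewrite mulnK //.
rewrite (sum_ord_mul _ _ (fun t => v k (i + t * a)%N (j + t * a)%N)).
by apply: eq_bigr => t _; apply: eq_bigr => s _; rewrite mulnDl !addnA mulnA.
Qed.

Lemma coarse_self k i j : coarse k (p k) i j = v k i j.
Proof. by rewrite /coarse divnn p_gt0 big_ord1 !mul0n !addn0. Qed.

(** Each step up is refined through the size of the level below, where [v_coh] replaces the finer
    units by those of that level. *)
Lemma coarse_level k l a i j : (k <= l)%N -> (a %| p k)%N ->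
  (i < a)%N -> (j < a)%N -> coarse l a i j = coarse k a i j.
Proof.
move=> /subnKC <- apk ia ja; elim: (l - k)%N => [|d IH]; first by rewrite addn0.
have ad : (a %| p (k + d))%N by apply: dvdn_trans apk (chain_dvd (leq_addr _ _)).
rewrite addnS -IH (@coarse_refine _ a (p (k + d))) //.
apply: eq_bigr => t _; rewrite /coarse -v_coh //.
  by rewrite -[ltnRHS](divnK ad) [ltnRHS]mulnC ltn_add_mul.
by rewrite -[ltnRHS](divnK ad) [ltnRHS]mulnC ltn_add_mul.
Qed.

(** By [coarse_level] the level from which the units of a divisor are computed is immaterial; hence
    coherence at consecutive levels suffices to get coherence along all divisibilities. *)
Lemma coherent_coarse : exists u : nat -> nat -> nat -> V,
  [/\ coherent (divisors_of p) u,
      forall a, divisors_of p a ->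
        exists2 k, (a %| p k)%N & u a = coarse k a &
      forall k i j, (i < p k)%N -> (j < p k)%N -> u (p k) i j = v k i j].
Proof.
(* The default level 0 is only taken when [a] divides no [p k]. *)
pose lv a := xget 0%N [set k | (a %| p k)%N].
have lvP a : divisors_of p a -> (a %| p (lv a))%N.
  by case=> k ak; rewrite /lv; case: xgetP => [? _ //|/(_ k)].
have lvE a k i j : divisors_of p a -> (a %| p k)%N -> (i < a)%N -> (j < a)%N ->
    coarse (lv a) a i j = coarse k a i j.
  move=> Da ak ia ja; case: (leqP k (lv a)) => [|/ltnW] kl.
    exact: coarse_level.
  by rewrite (coarse_level kl) // lvP.
exists (fun a => coarse (lv a) a); split=> [a b Db ab i j ia ja|a Da|k i j ik jk].
- have Da : divisors_of p a by case: Db => k bk; exists k; apply: dvdn_trans bk.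
  rewrite (lvE _ (lv b)) //; last exact: dvdn_trans (lvP _ Db).
  by apply: coarse_refine => //; apply: lvP.
- by exists (lv a) => //; apply: lvP.
- by rewrite (lvE _ k) // ?coarse_self //; exists k.
Qed.

End Coarsening.

(** The block-diagonal matrix whose diagonal blocks of size [a] all equal [c]. *)
Definition lift_coef (K : nzRingType) a (c : nat -> nat -> K) i j : K :=
  if (i %/ a == j %/ a)%N then c (i %% a)%N (j %% a)%N else 0.

Section MatrixSystem.
Variables (F : fieldType) (D : set nat).

Definition matrix_system (A : algType F) (u : nat -> nat -> nat -> A) : Prop :=
  [/\ dirset D, forall N, D N -> mxunits N (u N), coherent D u &
      forall a, exists N c, D N /\ a = mxcomb N (u N) c].

Lemma mxcomb_lift (A : algType F) (u : nat -> nat -> nat -> A) a b c :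
  dirset D -> coherent D u -> D b -> (a %| b)%N ->
  mxcomb a (u a) c = mxcomb b (u b) (lift_coef a c).
Proof.
move=> [_ Dpos _ _] coh Db ab; have /dvdnP[q bE] := ab.
have : (0 < b)%N by exact: Dpos.
rewrite {1}bE muln_gt0 => /andP[q0 a0].
pose f i j := lift_coef a c i j *: u b i j.
transitivity (\sum_(i < a * q) \sum_(j < a * q) f i j); last by rewrite mulnC -bE.
rewrite (sum_ord_mul _ _ (fun i => \sum_(j < a * q) f i j)).
apply: eq_bigr => i _.
under [RHS]eq_bigr do rewrite (sum_ord_mul _ _ (f _)).
rewrite exchange_big; apply: eq_bigr => j _ /=.
rewrite (coh _ _ Db ab) // scaler_sumr bE mulnK //; apply: eq_bigr => t _.
(* The left side becomes a sum over all column blocks [s] in which only [s = t] contributes,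
   matching the coefficients of [lift_coef]. *)
rewrite -[LHS](sum_ord_pred1 (fun s => c i j *: u (q * a)%N (i + t * a)%N
  (j + s * a)%N) (ltn_ord t)).
apply: eq_bigr => s _.
rewrite /f /lift_coef !divn_add_mul // !modn_add_mul // eq_sym bE.
by case: eqP; rewrite ?scale0r.
Qed.
End MatrixSystem.

(** * Matrix systems *)

(** An element has many representations as a combination, so the isomorphisms are first given as
    relations. Linearity reduces single-valuedness and injectivity of [R] to the two conditions at
    0. *)
Lemma relation_lrmorphism (K : nzRingType) (A B : algType K) (R : A -> B -> Prop) :
  (forall a, exists b, R a b) -> (forall b, exists a, R a b) ->
  (forall k a b a' b', R a b -> R a' b' -> R (k *: a + a') (k *: b + b')) ->
  (forall a b a' b', R a b -> R a' b' -> R (a * a') (b * b')) -> R 1 1 ->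
  (forall b, R 0 b -> b = 0) -> (forall a, R a 0 -> a = 0) ->
  exists f : {lrmorphism A -> B}, bijective f /\ forall a, R a (f a).
Proof.
move=> /choice[f fR] /choice[g gR] Rlin RM R1 R0 R0'.
have RB a b a' b' : R a b -> R a' b' -> R (a - a') (b - b').
  by move=> ab ab'; rewrite addrC -scaleN1r [b - _]addrC -scaleN1r; apply: Rlin.
have funR a b b' : R a b -> R a b' -> b = b'.
  by move=> ab /(RB _ _ _ _ ab); rewrite subrr => /R0/eqP; rewrite subr_eq0 => /eqP.
have injR a a' b : R a b -> R a' b -> a = a'.
  by move=> ab /(RB _ _ _ _ ab); rewrite subrr => /R0'/eqP; rewrite subr_eq0 => /eqP.
have flin : linear f by move=> k x y; apply: funR (fR _) _; apply: Rlin.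
have fmul : monoid_morphism f.
  by split=> [|x y]; apply: funR (fR _) _ => //; apply: RM.
pose hl := GRing.isLinear.Build K A B *:%R f flin.
pose hm := GRing.isMonoidMorphism.Build A B f fmul.
pose H : {lrmorphism A -> B} := HB.pack f hl hm.
exists H; split=> //; exists g => x.
  by apply: injR (gR _) (fR _).
by apply: funR (fR _) (gR _).
Qed.

Section MatrixSystemTheory.
Variables (F : fieldType) (D : set nat).

Lemma matrix_system_common (A : algType F) u (s : seq A) : matrix_system D u ->
  exists2 N, D N & forall a, a \in s -> exists c, a = mxcomb N (u N) c.
Proof.
move=> [Ddir uu coh full]; have [[N0 DN0] _ Dcup _] := Ddir.
elim: s => [|a s [N DN sN]]; first by exists N0.
have [M [c [DM ac]]] := full a; have [P DP [NP MP]] := Dcup _ _ DN DM.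
exists P => // b; rewrite inE => /orP[/eqP->|/sN[d ->]].
  by exists (lift_coef M c); rewrite ac (mxcomb_lift c Ddir coh DP MP).
by exists (lift_coef N d); rewrite (mxcomb_lift d Ddir coh DP NP).
Qed.

Lemma matrix_system_iso (A1 A2 : algType F) u1 u2 :
  @matrix_system F D A1 u1 -> @matrix_system F D A2 u2 -> alg_iso A1 A2.
Proof.
move=> [Ddir uu1 coh1 full1] [_ uu2 coh2 full2].
have [[N0 DN0] _ Dcup _] := Ddir.
pose R a b := exists N c,
  [/\ D N, a = mxcomb N (u1 N) c & b = mxcomb N (u2 N) c].
(* Lifting coefficients to a common size depends only on the sizes, hence is the same operation in
   both algebras. *)
have R2 a b a' b' : R a b -> R a' b' -> exists N c c', [/\ D N,
    a = mxcomb N (u1 N) c, b = mxcomb N (u2 N) c,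
    a' = mxcomb N (u1 N) c' & b' = mxcomb N (u2 N) c'].
  move=> [N [c [DN -> ->]]] [M [d [DM -> ->]]].
  have [P DP [NP MP]] := Dcup _ _ DN DM.
  exists P, (lift_coef N c), (lift_coef M d); split=> //.
  - exact: (mxcomb_lift c Ddir coh1 DP NP).
  - exact: (mxcomb_lift c Ddir coh2 DP NP).
  - exact: (mxcomb_lift d Ddir coh1 DP MP).
  - exact: (mxcomb_lift d Ddir coh2 DP MP).
have z1 N : mxcomb N (u1 N) (fun _ _ => 0) = 0.
  by apply: big1 => i _; apply: big1 => j _; rewrite scale0r.
have z2 N : mxcomb N (u2 N) (fun _ _ => 0) = 0.
  by apply: big1 => i _; apply: big1 => j _; rewrite scale0r.
have [|||||||f [fbij _]] := @relation_lrmorphism F A1 A2 R; last by exists f.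
- by move=> a; have [N [c [DN ->]]] := full1 a; exists (mxcomb N (u2 N) c), N, c.
- by move=> a; have [N [c [DN ->]]] := full2 a; exists (mxcomb N (u1 N) c), N, c.
- move=> k a b a' b' ab /(R2 _ _ _ _ ab)[N [c [c' [DN -> -> -> ->]]]].
  by exists N, (fun i j => k * c i j + c' i j); rewrite !mxcomb_linear.
- move=> a b a' b' ab /(R2 _ _ _ _ ab)[N [c [c' [DN -> -> -> ->]]]].
  exists N, (fun i j => \sum_(k < N) c i k * c' k j).
  by rewrite !mxcomb_mul //; [exact: uu2|exact: uu1].
- exists N0, (fun i j => (i == j)%:R).
  by rewrite !mxcomb1 //; [exact: uu2|exact: uu1].
- move=> b [N [c [DN /esym c0 ->]]]; rewrite -(z2 N); apply: eq_mxcomb => i j iN jN.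
  by apply: (mxcomb_inj (uu1 _ DN) (d := fun _ _ => 0)) => //; rewrite z1.
- move=> b [N [c [DN -> /esym c0]]]; rewrite -(z1 N); apply: eq_mxcomb => i j iN jN.
  by apply: (mxcomb_inj (uu2 _ DN) (d := fun _ _ => 0)) => //; rewrite z2.
Qed.

Lemma matrix_system_locally_matrix (A : algType F) u :
  @matrix_system F D A u -> locally_matrix A.
Proof.
move=> sys s; have [N DN sN] := matrix_system_common s sys.
have [[_ Dpos _ _] uu _ _] := sys.
have uN := uu _ DN; have := Dpos _ DN.
case: N DN uN sN => // n DN uN sN _.
have [f [finj fE]] := mxunits_morphism uN.
exists n, (range f); split.
  by split; [exact: lrmorphism_range_closed|exists f].
move=> a /sN[c ->]; exists (\matrix_(i, j) c i j) => //.
by rewrite fE; apply: eq_bigr => i _; apply: eq_bigr => j _; rewrite mxE.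
Qed.

(** Under a unital embedding of the matrices of size [n.+1], the image of [delta_mx ord0 ord0] has
    relative rang [1 / n.+1]. Computed at some [N] in [D], this rang is a multiple of [1 / N], so
    [n.+1] divides [N] and lies in [D]. The units themselves give the other inclusion. *)
Lemma matrix_system_sizes (R : realType) (A : algType F) u :
  @matrix_system F D A u ->
  [set n.+1 | n in [set n | exists B : set A, subalgebra_iso 'M[F]_n.+1 B]] = D.
Proof.
move=> sys; have Alm := matrix_system_locally_matrix sys.
have [[_ Dpos _ Ddown] uu _ full] := sys.
apply/seteqP; split=> [_ [n [B [_ [f [finj _]]]] <-]|N DN].
  have [N [c [DN fc]]] := full (f (delta_mx ord0 ord0)).
  apply: (Ddown _ N) => //.
  have uN := uu _ DN; have := Dpos _ DN.
  case: N DN fc uN => // m DN fc uN _.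
  have [g [ginj gE]] := mxunits_morphism uN.
  have gf : g (\matrix_(i, j) c i j) = f (delta_mx ord0 ord0).
    rewrite fc gE; apply: eq_bigr => i _; apply: eq_bigr => j _.
    by rewrite mxE.
  have := relative_rangE Alm R (delta_mx ord0 ord0) finj.
  rewrite -gf relative_rangE // mxrank_delta => /eqP.
  rewrite eqr_div ?pnatr_eq0 // -!natrM eqr_nat mul1n => /eqP <-.
  exact: dvdn_mull.
have uN := uu _ DN; have := Dpos _ DN.
case: N DN uN => // n DN uN _.
have [f [finj fE]] := mxunits_morphism uN.
exists n => //; exists (range f); split; first exact: lrmorphism_range_closed.
by exists f.
Qed.

End MatrixSystemTheory.

(** Blocks with different numbers multiply to 0, because an equality between [j + t * a] and
    [k + s * a] forces both [j = k] and [t = s]. *)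
Lemma mxunits_coarse (F : fieldType) (A : algType F) a q (v : nat -> nat -> A) :
  mxunits (a * q) v ->
  mxunits a (fun i j => \sum_(t < q) v (i + t * a)%N (j + t * a)%N).
Proof.
move=> [vM v1]; split=> [i j k l ia ja ka la|]; last first.
  by rewrite -(sum_ord_mul _ _ (fun i => v i i)).
rewrite mulr_suml; under eq_bigr => t _.
  rewrite mulr_sumr; under eq_bigr => s _.
    rewrite vM ?ltn_add_mul //.
    rewrite (_ : (_ == _) = (j == k) && (s == t :> nat)); last first.
      apply/eqP/andP => [E|[/eqP-> /eqP->] //].
      have := congr1 (modn^~ a) E; have := congr1 (divn^~ a) E.
      by rewrite !divn_add_mul // !modn_add_mul // => -> ->.
    over.
  over.
case: eqP => [jk|_] /=; last by apply: big1 => t _; rewrite big1.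
apply: eq_bigr => t _.
by rewrite (sum_ord_pred1 (fun s => v (i + t * a)%N (l + s * a)%N)).
Qed.

Lemma chain_mxunits (F : fieldType) (A : algType F) (p : nat -> nat)
    (v : nat -> nat -> nat -> A) :
  (forall k, (p k %| p k.+1)%N) -> (forall k, mxunits (p k) (v k)) ->
  (forall k i j, (i < p k)%N -> (j < p k)%N ->
     v k i j = \sum_(t < p k.+1 %/ p k) v k.+1 (i + t * p k)%N (j + t * p k)%N) ->
  exists u, [/\ forall a, divisors_of p a -> mxunits a (u a),
    coherent (divisors_of p) u &
    forall k i j, (i < p k)%N -> (j < p k)%N -> u (p k) i j = v k i j].
Proof.
move=> pd vu vcoh; have p0 k : (0 < p k)%N := mxunits_gt0 (vu k).
have [u [ucoh uc uv]] := coherent_coarse p0 pd vcoh.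
exists u; split=> // a Da.
have [k /dvdnP[q pk] ->] := uc _ Da.
have := vu k; have := p0 k; rewrite /coarse pk mulnC muln_gt0 => /andP[a0 q0].
by rewrite mulKn //; apply: mxunits_coarse.
Qed.

(** * Partitions into elements of equal rang *)

Lemma F2P (a : 'F_2) : a = 0 \/ a = 1.
Proof. by case: a => -[|[|//]] ?; [left|right]; apply: val_inj. Qed.

Section HammingUnits.
Variables (R : realType) (S : hammingSpace R).
Implicit Types (x : nat -> S) (c : nat -> 'F_2).

Definition hunits (N : nat) x : Prop :=
  [/\ forall i, (i < N)%N -> rang (x i) = N%:R^-1,
      forall i j, (i < N)%N -> (j < N)%N -> i != j -> x i * x j = 0 &
      \sum_(i < N) x i = 1].

Variables (N : nat) (x : nat -> S).
Hypothesis xx : hunits N x.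

Lemma hunits_gt0 : (0 < N)%N.
Proof.
have [_ _] := xx; case: N => // /esym/eqP.
by rewrite big_ord0 oner_eq0.
Qed.

Lemma hunits_neq0 i : (i < N)%N -> x i != 0.
Proof.
move=> iN; apply/eqP => /rang_eq0; have [-> // _ _] := xx.
by move/eqP; rewrite invr_eq0 pnatr_eq0 -leqn0 leqNgt hunits_gt0.
Qed.

Lemma lcomb_coef c i : (i < N)%N -> x i * lcomb N x c = c i *: x i.
Proof.
move=> iN; rewrite mulr_sumr (bigD1 (Ordinal iN)) //= big1 ?addr0 => [|j].
  by rewrite -scalerAr hamming_idem.
rewrite -val_eqE /= eq_sym => ij; have [_ xo _] := xx.
by rewrite -scalerAr xo ?scaler0.
Qed.

Lemma lcomb_inj c d i : lcomb N x c = lcomb N x d -> (i < N)%N -> c i = d i.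
Proof.
move=> cd iN; apply/eqP; rewrite -subr_eq0.
have: (c i - d i) *: x i == 0 by rewrite scalerBl -!lcomb_coef // cd subrr.
by rewrite scaler_eq0 (negPf (hunits_neq0 iN)) orbF.
Qed.

Lemma hunits_mul i j : (i < N)%N -> (j < N)%N ->
  x i * x j = if i == j then x i else 0.
Proof.
have [_ xo _] := xx; move=> iN jN; case: eqP => [<-|/eqP ij].
  by rewrite hamming_idem.
exact: xo.
Qed.

Lemma lcomb1 : lcomb N x (fun=> 1) = 1.
Proof. by have [_ _ <-] := xx; apply: eq_bigr => i _; rewrite scale1r. Qed.

Lemma rang_lcomb c : rang (lcomb N x c) = (\sum_(i < N) (c i : nat))%:R / N%:R.
Proof.
have [xr xo _] := xx.
(* Additivity of [rang] is available for two disjoint elements only, so partial sums are treated one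
   term at a time. *)
suff H m : (m <= N)%N ->
    rang (\sum_(i < m) c i *: x i) = (\sum_(i < m) (c i : nat))%:R / N%:R by exact: H.
elim: m => [|m IH] mN.
  by rewrite !big_ord0 mul0r; apply/rang_eq0.
rewrite !big_ord_recr /= rangD ?IH 1?ltnW //.
  rewrite natrD mulrDl; congr (_ + _).
  case: (F2P (c m)) => ->; first by rewrite scale0r mul0r; apply/rang_eq0.
  by rewrite scale1r mul1r xr.
rewrite mulr_suml big1 // => i _; rewrite -scalerAl -scalerAr xo ?scaler0 //.
  exact: leq_trans (ltn_ord i) (ltnW mN).
by rewrite neq_ltn ltn_ord.
Qed.

End HammingUnits.

Definition cube_delta n (i : 'I_n.+1) : cube n := [ffun j => (j == i)%:R].

Lemma cube_sum n (c : cube n) : c = \sum_i c i *: cube_delta i.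
Proof.
apply/ffunP => j; rewrite sum_ffunE (bigD1 j) //= big1 ?addr0 => [|i ij].
  by rewrite !ffunE eqxx [_ *: _]mulr1.
by rewrite !ffunE eq_sym (negPf ij) [_ *: _]mulr0.
Qed.

Lemma hunits_cube (R : realType) n :
  hunits n.+1 (fun i => cube_delta (inord i) : standard_hamming R n).
Proof.
split=> [i iN|i j iN jN ij|].
- rewrite /rang /= /cube_rang (bigD1 (inord i)) //= big1 => [|j ji].
    by rewrite ffunE eqxx addr0 mul1r.
  by rewrite ffunE (negPf ji).
- apply/ffunP => k; rewrite !ffunE; case: eqP => [->|]; last by rewrite mul0r.
  by rewrite -val_eqE /= !inordK // (negPf ij) mulr0.
- rewrite [RHS]cube_sum; apply: eq_bigr => i _.
  by rewrite ffunE scale1r inord_val.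
Qed.

Lemma hunits_morphism (R : realType) (S : hammingSpace R) n (x : nat -> S) :
  hunits n.+1 x ->
  exists f : {lrmorphism standard_hamming R n -> S},
    [/\ injective f, forall a, rang (f a) = rang a &
        forall a, f a = \sum_(i < n.+1) a i *: x i].
Proof.
move=> xx; pose c (a : cube n) (i : nat) : 'F_2 := a (inord i).
pose h (a : standard_hamming R n) : S := lcomb n.+1 x (c a).
have hlin : linear h.
  move=> k a b; rewrite /h -lcomb_linear; apply: eq_lcomb => i _.
  by rewrite /c !ffunE.
have hmul : monoid_morphism h.
  split=> [|a b]; rewrite /h.
    by rewrite -(lcomb1 xx); apply: eq_lcomb => i _; rewrite /c ffunE.
  rewrite lcomb_mul; last exact: (hunits_mul xx).
  by apply: eq_lcomb => i _; rewrite /c ffunE.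
pose hl := GRing.isLinear.Build 'F_2 (standard_hamming R n) S *:%R h hlin.
pose hm := GRing.isMonoidMorphism.Build (standard_hamming R n) S h hmul.
pose H : {lrmorphism standard_hamming R n -> S} := HB.pack h hl hm.
exists H; split=> [a b ab|a|a].
- apply/ffunP => i.
  by have := lcomb_inj xx ab (ltn_ord i); rewrite /c inord_val.
- rewrite [LHS]rang_lcomb // natr_sum /rang /= /cube_rang; congr (_ / _).
  by apply: eq_bigr => i _; rewrite /c inord_val.
- by apply: eq_bigr => i _; rewrite /c inord_val.
Qed.

Lemma morphism_hunits (R : realType) (S T : hammingSpace R)
    (f : {lrmorphism S -> T}) N (x : nat -> S) :
  (forall a, rang (f a) = rang a) -> hunits N x -> hunits N (f \o x).
Proof.
move=> fr [xr xo x1]; split=> [i iN|i j iN jN ij|] /=.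
- by rewrite fr xr.
- by rewrite -rmorphM /= xo // raddf0.
- by rewrite -[RHS](rmorph1 f) -x1 raddf_sum.
Qed.

(** * Hamming systems *)

Section HammingSystem.
Variables (R : realType) (D : set nat).

(** [coherent] is stated for doubly indexed families; the second index is a dummy here. *)
Definition hamming_system (S : hammingSpace R) (x : nat -> nat -> S) : Prop :=
  [/\ dirset D, forall N, D N -> hunits N (x N),
      coherent D (fun N i _ => x N i) &
      forall a, exists N c, D N /\ a = lcomb N (x N) c].

Lemma hamming_system_iso (S1 S2 : hammingSpace R) x1 x2 :
  @hamming_system S1 x1 -> @hamming_system S2 x2 -> hamming_iso S1 S2.
Proof.
move=> [Ddir xx1 coh1 full1] [_ xx2 coh2 full2].
have [[N0 DN0] _ Dcup _] := Ddir.
pose P a b := exists N c,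
  [/\ D N, a = lcomb N (x1 N) c & b = lcomb N (x2 N) c].
have P2 a b a' b' : P a b -> P a' b' -> exists N c c', [/\ D N,
    a = lcomb N (x1 N) c, b = lcomb N (x2 N) c,
    a' = lcomb N (x1 N) c' & b' = lcomb N (x2 N) c'].
  move=> [N [c [DN -> ->]]] [M [d [DM -> ->]]].
  have [Q DQ [NQ MQ]] := Dcup _ _ DN DM.
  exists Q, (fun i => c (i %% N)%N), (fun i => d (i %% M)%N); split=> //.
  - exact: (lcomb_lift c Ddir coh1 DQ NQ).
  - exact: (lcomb_lift c Ddir coh2 DQ NQ).
  - exact: (lcomb_lift d Ddir coh1 DQ MQ).
  - exact: (lcomb_lift d Ddir coh2 DQ MQ).
have z1 N : lcomb N (x1 N) (fun _ => 0) = 0.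
  by apply: big1 => i _; rewrite scale0r.
have z2 N : lcomb N (x2 N) (fun _ => 0) = 0.
  by apply: big1 => i _; rewrite scale0r.
have [|||||||f [fbij fP]] := @relation_lrmorphism 'F_2 S1 S2 P; last first.
  exists f; split=> // a; have [N [c [DN -> ->]]] := fP a.
  by rewrite !rang_lcomb //; [exact: xx1|exact: xx2].
- move=> b [N [c [DN -> /esym c0]]]; rewrite -(z1 N); apply: eq_lcomb => i iN.
  by apply: (lcomb_inj (xx2 _ DN) (d := fun _ => 0)) => //; rewrite z2.
- move=> b [N [c [DN /esym c0 ->]]]; rewrite -(z2 N); apply: eq_lcomb => i iN.
  by apply: (lcomb_inj (xx1 _ DN) (d := fun _ => 0)) => //; rewrite z1.
- by exists N0, (fun=> 1); rewrite !lcomb1 //; [exact: xx2|exact: xx1].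
- move=> a b a' b' ab /(P2 _ _ _ _ ab)[N [c [c' [DN -> -> -> ->]]]].
  exists N, (fun i => c i * c' i).
  by rewrite !lcomb_mul //; [exact/hunits_mul/xx2|exact/hunits_mul/xx1].
- move=> k a b a' b' ab /(P2 _ _ _ _ ab)[N [c [c' [DN -> -> -> ->]]]].
  by exists N, (fun i => k * c i + c' i); rewrite !lcomb_linear.
- by move=> a; have [N [c [DN ->]]] := full2 a; exists (lcomb N (x1 N) c), N, c.
- by move=> a; have [N [c [DN ->]]] := full1 a; exists (lcomb N (x2 N) c), N, c.
Qed.

(** Every element is a combination at some [N] in [D], so its rang is a multiple of [1 / N]. The
    image of a coordinate vector of the cube has rang [1 / n.+1], whence [n.+1] divides [N]. *)
Lemma hamming_system_sizes (S : hammingSpace R) x :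
  @hamming_system S x ->
  [set n.+1 | n in [set n | exists T : set S,
    hamming_subspace_iso (standard_hamming R n) T]] = D.
Proof.
move=> [[_ Dpos _ Ddown] xx _ full].
apply/seteqP; split=> [_ [n [T [_ [f [finj _ fr]]]] <-]|N DN].
  have [N [c [DN fc]]] := full (f (cube_delta (inord 0))).
  apply: (Ddown _ N) => //.
  have [/(_ 0%N) + _ _] := morphism_hunits fr (hunits_cube R n).
  rewrite /= fc rang_lcomb; last exact: xx.
  have N0 := Dpos _ DN.
  move=> /(_ isT)/eqP; rewrite -[X in _ == X]mul1r eqr_div ?pnatr_eq0 -?lt0n //.
  by rewrite mul1r -natrM eqr_nat => /eqP <-; apply: dvdn_mull.
have xN := xx _ DN; have := Dpos _ DN.
case: N DN xN => // n DN xN _.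
have [f [finj fr fE]] := hunits_morphism xN.
exists n => //; exists (range f); split; first exact: lrmorphism_range_closed.
by exists f.
Qed.

End HammingSystem.

Lemma hunits_coarse (R : realType) (S : hammingSpace R) a q (y : nat -> S) :
  (0 < q)%N -> hunits (a * q) y -> hunits a (fun i => \sum_(t < q) y (i + t * a)%N).
Proof.
move=> q0 yy; have [yr yo y1] := yy.
have a0 : (0 < a)%N by have := hunits_gt0 yy; rewrite muln_gt0 => /andP[].
split=> [i ia|i j ia ja ij|]; last by rewrite -(sum_ord_mul _ _ y).
  (* Each term contributes [1 / (a * q)]; all [q] of them give [1 / a]. *)
  suff H m : (m <= q)%N ->
      rang (\sum_(t < m) y (i + t * a)%N) = m%:R / (a * q)%:R.
    rewrite H // natrM invfM mulrCA mulfV ?mulr1 //.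
    by rewrite pnatr_eq0 -lt0n.
  elim: m => [|m IH] mq; first by rewrite big_ord0 mul0r; apply/rang_eq0.
  have mq' : (m <= q)%N by exact: ltnW.
  rewrite big_ord_recr /= rangD; first rewrite IH // yr ?ltn_add_mul //.
    by rewrite -[X in _ + X]mul1r -mulrDl natr1.
  rewrite mulr_suml big1 // => t _; apply: yo; rewrite ?ltn_add_mul //.
    exact: ltn_trans (ltn_ord t) mq.
  by rewrite eqn_add2l eqn_mul2r negb_or -lt0n a0 neq_ltn ltn_ord.
rewrite mulr_suml big1 // => t _; rewrite mulr_sumr big1 // => s _.
apply: yo; rewrite ?ltn_add_mul //; apply: contra_neq ij => /(congr1 (modn^~ a)).
by rewrite !modn_add_mul.
Qed.

Lemma chain_hamming_system (R : realType) (S : hammingSpace R) (p : nat -> nat)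
    (y : nat -> nat -> S) :
  (forall k, (p k %| p k.+1)%N) -> (forall k, hunits (p k) (y k)) ->
  (forall k i, (i < p k)%N ->
     y k i = \sum_(t < p k.+1 %/ p k) y k.+1 (i + t * p k)%N) ->
  (forall a, exists k c, a = lcomb (p k) (y k) c) ->
  exists x, @hamming_system R (divisors_of p) S x.
Proof.
move=> pd yy ycoh full; have p0 k : (0 < p k)%N := hunits_gt0 (yy k).
have ycoh' k i (j : nat) : (i < p k)%N -> (j < p k)%N -> y k i =
     \sum_(t < p k.+1 %/ p k) (fun k i (_ : nat) => y k i) k.+1 (i + t * p k)%N
       (j + t * p k)%N by move=> ip _; exact: ycoh.
have [u [ucoh uc uv]] := coherent_coarse p0 pd ycoh'.
exists (fun N i => u N i i); split=> [|a Da|a b Db ab i j ia ja|a].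
- exact: dirset_divisors_of.
- have [k /dvdnP[q pk] ->] := uc _ Da.
  have := yy k; have := p0 k; rewrite /coarse pk mulnC muln_gt0 => /andP[a0 q0].
  by rewrite mulKn //; apply: hunits_coarse.
- by rewrite (ucoh _ _ Db ab).
- have [k [c ->]] := full a; exists (p k), c; split; first by exists k.
  by apply: eq_bigr => i _; rewrite uv.
Qed.

(** * Products of commuting matrix units *)

Section CommutingUnits.
Variables (F : fieldType) (A : algType F) (n : nat -> nat).
Variable e : nat -> nat -> nat -> A.
Hypothesis e_units : forall i, mxunits (n i).+1 (e i).
Hypothesis e_comm : forall i j a b c d, i != j -> (a <= n i)%N -> (b <= n i)%N ->
  (c <= n j)%N -> (d <= n j)%N -> e i a b * e j c d = e j c d * e i a b.

Definition psize k : nat := \prod_(i < k) (n i).+1.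

(** Mixed radix with the least significant digit first. The [i]-th base is [(n i).+1], so [n i] is
    the largest digit. *)
Definition digit i I : nat := ((I %/ psize i) %% (n i).+1)%N.

Definition punits k I J : A := \prod_(i < k) e i (digit i I) (digit i J).

Lemma psizeS k : psize k.+1 = (psize k * (n k).+1)%N.
Proof. exact: big_ord_recr. Qed.

Lemma psize_gt0 k : (0 < psize k)%N.
Proof. by apply: prodn_gt0. Qed.

Lemma psize_dvdS k : (psize k %| psize k.+1)%N.
Proof. by rewrite psizeS dvdn_mulr. Qed.

Lemma psize_dvd k l : (k <= l)%N -> (psize k %| psize l)%N.
Proof. exact: (chain_dvd psize_dvdS). Qed.

Lemma digit_le i I : (digit i I <= n i)%N.
Proof. by rewrite -ltnS ltn_pmod. Qed.

Lemma digit_low m k i t : (m < k)%N -> digit m (i + t * psize k) = digit m i.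
Proof.
move=> mk; have /dvdnP[q ->] := psize_dvd mk.
rewrite /digit psizeS (mulnCA q) (mulnCA t) addnC [(psize m * _)%N]mulnC.
by rewrite divnMDl ?psize_gt0 // mulnA modnMDl.
Qed.

Lemma digit_top k i t : (i < psize k)%N -> (t <= n k)%N ->
  digit k (i + t * psize k) = t.
Proof. by move=> ik tk; rewrite /digit divn_add_mul // modn_small. Qed.

(** Serves to recognise a family of matrix units, one per factor, as given by the digits of a pair
    of indices. *)
Lemma digits_onto k (d : nat -> nat) : (forall i, (i < k)%N -> (d i <= n i)%N) ->
  exists2 I, (I < psize k)%N & forall i, (i < k)%N -> digit i I = d i.
Proof.
elim: k => [|k IH] dn; first by exists 0%N => //; rewrite psize_gt0.
have [|I Ik Id] := IH; first by move=> i ik; apply: dn; exact: ltnW.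
exists (I + d k * psize k)%N; first by rewrite psizeS ltn_add_mul // ltnS dn.
move=> i; rewrite ltnS leq_eqVlt => /orP[/eqP->|ik]; first by rewrite digit_top ?dn.
by rewrite digit_low ?Id.
Qed.

Lemma punitsS k i j t s : (i < psize k)%N -> (j < psize k)%N ->
  (t <= n k)%N -> (s <= n k)%N ->
  punits k.+1 (i + t * psize k) (j + s * psize k) = punits k i j * e k t s.
Proof.
move=> ik jk tn sn; rewrite /punits big_ord_recr /= !digit_top //; congr (_ * _).
by apply: eq_bigr => m _; rewrite !digit_low.
Qed.

Lemma punits_comm k I J t s : (t <= n k)%N -> (s <= n k)%N ->
  punits k I J * e k t s = e k t s * punits k I J.
Proof.
move=> tn sn; apply/esym/commr_prod => i _; apply/esym/e_comm; rewrite ?digit_le //.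
by rewrite neq_ltn ltn_ord.
Qed.

(** By induction: the unit of the new factor is moved past the old product by commutation, and two
    indices agree exactly when their low parts and their top digits do. *)
Lemma punits_mxunits k : mxunits (psize k) (punits k).
Proof.
elim: k => [|k [IHM IH1]]; (split; [move=> i j l m|]).
- rewrite /psize big_ord0 !ltnS !leqn0 => /eqP-> /eqP-> /eqP-> /eqP->.
  by rewrite /punits !big_ord0 mulr1.
- by rewrite /psize big_ord0 big_ord1 /punits big_ord0.
- have [eM _] := e_units k; have P0 := psize_gt0 k.
  rewrite psizeS => iP jP lP mP.
  have lt1 x : (x < psize k * (n k).+1)%N -> (x %/ psize k <= n k)%N.
    by move=> xP; rewrite -(@ltnS _ (n k)) ltn_divLR // mulnC.
  have lt2 x : (x %% psize k < psize k)%N by rewrite ltn_mod.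
  rewrite (divn_eq i (psize k)) (divn_eq j (psize k)) (divn_eq l (psize k)).
  rewrite (divn_eq m (psize k)) ![(_ * psize k + _)%N]addnC.
  rewrite !punitsS ?lt1 ?lt2 // mulrA -[_ * e k _ _ * _]mulrA -punits_comm ?lt1 //.
  rewrite mulrA IHM ?lt2 // -mulrA eM ?ltnS ?lt1 //.
  case: eqP => [->|jl]; last first.
    by rewrite mul0r; case: eqP => // /(congr1 (modn^~ (psize k)));
       rewrite !modn_add_mul ?lt2 //.
  case: eqP => [->|jl]; first by rewrite eqxx.
  by rewrite mulr0; case: eqP => // /(congr1 (divn^~ (psize k)));
     rewrite !divn_add_mul ?lt2 //.
- rewrite psizeS (sum_ord_mul _ _ (fun i => punits k.+1 i i)) -IH1.
  apply: eq_bigr => i _; under eq_bigr do rewrite punitsS ?leq_ord //.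
  by rewrite -mulr_sumr (e_units k).2 mulr1.
Qed.

(** Multiplying by [1 = \sum_t e k t t], taken in the new factor, produces the finer units. *)
Lemma punits_coh k i j : (i < psize k)%N -> (j < psize k)%N -> punits k i j =
  \sum_(t < psize k.+1 %/ psize k) punits k.+1 (i + t * psize k) (j + t * psize k).
Proof.
move=> ik jk; rewrite psizeS mulKn ?psize_gt0 //.
under eq_bigr do rewrite punitsS ?leq_ord //.
by rewrite -mulr_sumr (e_units k).2 mulr1.
Qed.

(** Here 1 is inserted on the left, as the sum of the diagonal product units of the factors before
    [i]. *)
Lemma unit_punits i a b : (a <= n i)%N -> (b <= n i)%N ->
  e i a b = \sum_(r < psize i) punits i.+1 (r + a * psize i) (r + b * psize i).
Proof.
move=> an bn; under eq_bigr do rewrite punitsS ?leq_ord //.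
by rewrite -mulr_suml (punits_mxunits i).2 mul1r.
Qed.

End CommutingUnits.

(** * Spans of a coherent system and of its diagonal *)

Section Spans.
Variables (F : fieldType) (A : algType F) (D : set nat).
Variable u : nat -> nat -> nat -> A.

Definition mxspan : set A := [set a | exists N c, D N /\ a = mxcomb N (u N) c].

Definition dgspan : set A :=
  [set a | exists N c, D N /\ a = lcomb N (fun i => u N i i) c].

Hypothesis Ddir : dirset D.
Hypothesis u_units : forall N, D N -> mxunits N (u N).
Hypothesis u_coh : coherent D u.

Lemma mxspan_closed : GRing.subalg_closed [in mxspan].
Proof.
have [[N0 DN0] _ Dcup _] := Ddir.
have common x y : mxspan x -> mxspan y -> exists N c d,
    [/\ D N, x = mxcomb N (u N) c & y = mxcomb N (u N) d].
  move=> [N [c [DN ->]]] [M [d [DM ->]]].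
  have [P DP [NP MP]] := Dcup _ _ DN DM.
  exists P, (lift_coef N c), (lift_coef M d); split=> //.
  - exact: (mxcomb_lift c Ddir u_coh DP NP).
  - exact: (mxcomb_lift d Ddir u_coh DP MP).
split=> [|a x y|x y].
- by apply/mem_set; exists N0, (fun i j => (i == j)%:R); rewrite mxcomb1 //; exact: u_units.
- move=> /set_mem xs /set_mem ys; apply/mem_set.
  have [N [c [d [DN -> ->]]]] := common x y xs ys.
  by exists N, (fun i j => a * c i j + d i j); rewrite mxcomb_linear.
- move=> /set_mem xs /set_mem ys; apply/mem_set.
  have [N [c [d [DN -> ->]]]] := common x y xs ys.
  exists N, (fun i j => \sum_(k < N) c i k * d k j).
  by rewrite mxcomb_mul //; exact: u_units.
Qed.

Lemma mxunits_diag N i j : D N -> (i < N)%N -> (j < N)%N ->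
  u N i i * u N j j = if i == j then u N i i else 0.
Proof.
by move=> DN iN jN; rewrite (u_units DN).1 //; case: eqP => [->|].
Qed.

Lemma dgspan_closed : GRing.subalg_closed [in dgspan].
Proof.
have [[N0 DN0] _ Dcup _] := Ddir.
have dcoh : coherent D (fun N i _ => u N i i).
  by move=> a b Db ab i j ia ja; apply: u_coh.
have common x y : dgspan x -> dgspan y -> exists N c d,
    [/\ D N, x = lcomb N (fun i => u N i i) c & y = lcomb N (fun i => u N i i) d].
  move=> [N [c [DN ->]]] [M [d [DM ->]]].
  have [P DP [NP MP]] := Dcup _ _ DN DM.
  exists P, (fun i => c (i %% N)%N), (fun i => d (i %% M)%N); split=> //.
  - exact: (lcomb_lift (x := fun N i => u N i i) c Ddir dcoh DP NP).
  - exact: (lcomb_lift (x := fun N i => u N i i) d Ddir dcoh DP MP).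
split=> [|a x y|x y].
- apply/mem_set; exists N0, (fun=> 1); split=> //.
  by rewrite -(u_units DN0).2; apply: eq_bigr => i _; rewrite scale1r.
- move=> /set_mem xs /set_mem ys; apply/mem_set.
  have [N [c [d [DN -> ->]]]] := common x y xs ys.
  by exists N, (fun i => a * c i + d i); rewrite lcomb_linear.
- move=> /set_mem xs /set_mem ys; apply/mem_set.
  have [N [c [d [DN -> ->]]]] := common x y xs ys.
  exists N, (fun i => c i * d i); rewrite lcomb_mul //.
  by move=> i j; exact: mxunits_diag.
Qed.

End Spans.

Section ProductSystem.
Variables (F : fieldType) (A : algType F) (n : nat -> nat).
Variable e : nat -> nat -> nat -> A.
Hypothesis e_units : forall i, mxunits (n i).+1 (e i).
Hypothesis e_comm : forall i j a b c d, i != j -> (a <= n i)%N -> (b <= n i)%N ->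
  (c <= n j)%N -> (d <= n j)%N -> e i a b * e j c d = e j c d * e i a b.
Notation D := (divisors_of (psize n)).
Notation v := (punits n e).

Lemma dirset_psize : dirset D.
Proof. by apply: dirset_divisors_of => k; [exact: psize_gt0|exact: psize_dvdS]. Qed.

Lemma divisors_of_psize k : D (psize n k).
Proof. by exists k. Qed.

Lemma product_units : exists u, [/\ forall N, D N -> mxunits N (u N), coherent D u &
  forall k i j, (i < psize n k)%N -> (j < psize n k)%N -> u (psize n k) i j = v k i j].
Proof.
apply: chain_mxunits => [k|k|k i j].
- exact: psize_dvdS.
- exact: punits_mxunits.
- exact: punits_coh.
Qed.

Definition product_span : set A :=
  [set a | exists k c, a = mxcomb (psize n k) (v k) c].

Lemma product_mxspan u : coherent D u ->
  (forall k i j, (i < psize n k)%N -> (j < psize n k)%N ->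
     u (psize n k) i j = v k i j) -> product_span = mxspan D u.
Proof.
move=> ucoh uv; have uvc k c : mxcomb (psize n k) (u (psize n k)) c
    = mxcomb (psize n k) (v k) c.
  by apply: eq_bigr => i _; apply: eq_bigr => j _; rewrite uv.
apply/seteqP; split=> [a [k [c ->]]|_ [N [c [[k Nk] ->]]]].
  by exists (psize n k), c; split; [exact: divisors_of_psize|rewrite uvc].
exists k, (lift_coef N c).
rewrite (mxcomb_lift c dirset_psize ucoh _ Nk); last exact: divisors_of_psize.
exact: uvc.
Qed.

Lemma product_span_closed : GRing.subalg_closed [in product_span].
Proof.
have [u [uu ucoh uv]] := product_units.
by rewrite (product_mxspan ucoh uv); apply: mxspan_closed => //; exact: dirset_psize.
Qed.

Lemma unit_product_span i a b : (a <= n i)%N -> (b <= n i)%N ->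
  product_span (e i a b).
Proof.
move=> an bn; rewrite (unit_punits e_units e_comm) //.
apply: (subalg_closed_sum product_span_closed) => r.
exists i.+1; eexists; apply/esym; apply: mxcomb_delta;
  by rewrite psizeS ltn_add_mul.
Qed.

Definition unit_diag i : set A :=
  range (fun c : 'I_(n i).+1 -> F => \sum_(j < (n i).+1) c j *: e i j j).

(** A diagonal unit of one factor is a sum of diagonal product units, and conversely a diagonal
    product unit is a product of diagonal units of the factors. *)
Lemma generated_diag u : (forall N, D N -> mxunits N (u N)) -> coherent D u ->
  (forall k i j, (i < psize n k)%N -> (j < psize n k)%N ->
     u (psize n k) i j = v k i j) ->
  generated_subalgebra (\bigcup_i unit_diag i) = dgspan D u.
Proof.
move=> uu ucoh uv; have dgc := dgspan_closed dirset_psize uu ucoh.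
have gc := generated_subalg_closed (\bigcup_i unit_diag i).
apply/seteqP; split.
  apply: smallest_sub => // _ [i _ [c _ <-]]; apply: (subalg_closed_comb dgc) => j.
  rewrite (unit_punits e_units e_comm) ?leq_ord //.
  apply: (subalg_closed_sum dgc) => r.
  have rP : (r + j * psize n i < psize n i.+1)%N by rewrite psizeS ltn_add_mul.
  exists (psize n i.+1), (fun s => (s == r + j * psize n i)%N%:R).
  split; first exact: divisors_of_psize.
  rewrite -uv // -[LHS](sum_ord_pred1 (fun s => u (psize n i.+1) s s) rP).
  by apply: eq_bigr => s _; case: eqP; rewrite ?scale1r ?scale0r.
move=> _ [N [c [[k Nk] ->]]].
have dcoh : coherent D (fun N i _ => u N i i).
  by move=> a b Db ab i j ia ja; apply: ucoh.
have /= -> := lcomb_lift (x := fun N i => u N i i) c dirset_psize dcoh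
  (divisors_of_psize k) Nk.
apply: (subalg_closed_comb gc) => j; rewrite uv //.
apply: (subalg_closed_prod gc) => i E [_ XE]; apply: XE; exists (nat_of_ord i) => //.
exists (fun s : 'I_(n i).+1 => (s == digit n i j :> nat)%:R) => //.
have dn : (digit n i j < (n i).+1)%N by rewrite ltnS digit_le.
rewrite -[RHS](sum_ord_pred1 (fun s => e i s s) dn).
by apply: eq_bigr => s _; case: eqP; rewrite ?scale1r ?scale0r.
Qed.

End ProductSystem.

(** * Tensor products *)

Section Multilinear.
Variables (F : fieldType) (V : lmodType F) (k : nat) (B : 'I_k -> set V).
Hypothesis Blin : forall i a x y, B i x -> B i y -> B i (a *: x + y).

Lemma multilinear_on_comb (W : lmodType F) (g : ('I_k -> V) -> W) b i m
    (c : 'I_m -> F) (y : 'I_m -> V) :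
  multilinear_on B g -> (forall j, B j (b j)) -> (forall s, B i (y s)) ->
  g [eta b with i |-> \sum_(s < m) c s *: y s] =
    \sum_(s < m) c s *: g [eta b with i |-> y s].
Proof.
move=> gml Bb; have B0 : B i 0.
  by have := Blin (-1) (Bb i) (Bb i); rewrite scaleN1r addNr.
elim: m c y => [|m IH] c y By.
  (* With the scalar -1 and twice the same vector, multilinearity says that [g] vanishes when slot
     [i] is 0. *)
  have := gml b i (-1) _ _ Bb (Bb i) (Bb i).
  by rewrite !big_ord0 !scaleN1r !addNr.
have Bs : B i (\sum_(s < m) c (lift ord0 s) *: y (lift ord0 s)).
  by elim/big_rec: _ => // s x _ Bx; apply: Blin.
by rewrite !big_ord_recl gml // IH.
Qed.

(** The slots are expanded over [G] one after another: in the induction the slots from [m] on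
    already lie in [G], and expanding slot [m] leads from [m] to [m.+1]. *)
Lemma multilinear_on_ext (G : 'I_k -> set V) (W : lmodType F)
    (g1 g2 : ('I_k -> V) -> W) :
  multilinear_on B g1 -> multilinear_on B g2 -> (forall i, G i `<=` B i) ->
  (forall i x, B i x -> exists m (c : 'I_m -> F) (y : 'I_m -> V),
     (forall s, G i (y s)) /\ x = \sum_(s < m) c s *: y s) ->
  (forall b, (forall i, G i (b i)) -> g1 b = g2 b) ->
  forall b, (forall i, B i (b i)) -> g1 b = g2 b.
Proof.
move=> ml1 ml2 GB gen gE.
suff H m : (m <= k)%N -> forall b, (forall i, B i (b i)) ->
    (forall i : 'I_k, (m <= i)%N -> G i (b i)) -> g1 b = g2 b.
  move=> b Bb; apply: (H k) => // i; by rewrite leqNgt ltn_ord.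
elim: m => [|m IH] mk b Bb Gb; first by apply: gE => i; apply: Gb.
pose i := Ordinal mk; have [l [c [y [Gy bi]]]] := gen i _ (Bb i).
have -> : b = [eta b with i |-> \sum_(s < l) c s *: y s].
  by apply/funext => j /=; case: eqP => [->|].
rewrite !multilinear_on_comb //; try by move=> s; apply: GB.
apply: eq_bigr => s _; congr (_ *: _); apply: IH => [|j|j mj] /=.
- exact: ltnW.
- by case: eqP => [->|_]; [apply: GB|].
- case: eqP => [->//|/eqP ji]; apply: Gb.
  by rewrite ltn_neqAle mj andbT; apply: contra_neq ji => mj'; apply: val_inj.
Qed.

End Multilinear.

(** The factors need not commute, so the product is peeled off in order; the list of indices has no
    repetition, hence the changed slot is met exactly once. *)
Lemma prod_multilinear (F : fieldType) (A : algType F) k (B : 'I_k -> set A) :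
  multilinear_on B (fun b => \prod_(i < k) b i).
Proof.
move=> b i a x y _ _ _.
have : uniq (index_enum 'I_k) by rewrite index_enum_uniq.
have : i \in index_enum 'I_k by rewrite mem_index_enum.
elim: (index_enum _) => // j r IH; rewrite inE /= => ijr /andP[jr ur].
rewrite !big_cons; have [ji|ji] := eqVneq j i.
  have rE z : \prod_(l <- r) [eta b with i |-> z] l = \prod_(l <- r) b l.
    apply: eq_big_seq => l lr /=; case: eqP => // li.
    by move: lr; rewrite li -ji (negPf jr).
  by move: rE => /= rE; rewrite !rE mulrDl -scalerAl.
rewrite eq_sym (negPf ji) /= in ijr.
rewrite IH // mulrDr -scalerAr.
by [].
Qed.

(** The sizes [psize n k] are positive but not syntactically successors, the form that
    [mxunits_morphism] requires. *)
Lemma mxunits_linear (F : fieldType) (A : algType F) N (u : nat -> nat -> A) :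
  mxunits N u ->
  exists f : {linear 'M[F]_N -> A}, [/\ injective f,
    forall c : nat -> nat -> F, f (\matrix_(i, j) c i j) = mxcomb N u c &
    range f = [set mxcomb N u c | c in [set: nat -> nat -> F]]].
Proof.
move=> uu; have := mxunits_gt0 uu; case: N uu => // N uu _.
have [f [finj fE]] := mxunits_morphism uu.
have fc (c : nat -> nat -> F) : f (\matrix_(i, j) c i j) = mxcomb N.+1 u c.
  by rewrite fE; apply: eq_bigr => i _; apply: eq_bigr => j _; rewrite mxE.
exists f; split=> //; apply/seteqP; split=> [_ [M _ <-]|_ [c _ <-]]; last first.
  by exists (\matrix_(i, j) c i j) => //; exact: fc.
exists (fun i j => M (inord i) (inord j)) => //.
apply: etrans _ (esym (fE M)).
by apply: eq_bigr => i _; apply: eq_bigr => j _; rewrite !inord_val.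
Qed.

Section TensorProducts.
Variables (F : fieldType) (A : algType F) (n : nat -> nat).
Variable e : nat -> nat -> nat -> A.
Hypothesis e_units : forall i, mxunits (n i).+1 (e i).
Hypothesis e_comm : forall i j a b c d, i != j -> (a <= n i)%N -> (b <= n i)%N ->
  (c <= n j)%N -> (d <= n j)%N -> e i a b * e j c d = e j c d * e i a b.

Definition unit_span i : set A := [set b | exists c, b = mxcomb (n i).+1 (e i) c].

Lemma unit_span_lin i a x y :
  unit_span i x -> unit_span i y -> unit_span i (a *: x + y).
Proof.
by move=> [c ->] [d ->]; exists (fun k l => a * c k l + d k l); rewrite mxcomb_linear.
Qed.

Lemma prod_unit_span k (b : nat -> A) :
  (forall i, (i < k)%N -> unit_span i (b i)) ->
  exists c, \prod_(i < k) b i = mxcomb (psize n k) (punits n e k) c.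
Proof.
elim: k => [|k IH] bB.
  exists (fun i j => (i == j)%:R); rewrite mxcomb1 ?big_ord0 //.
  exact: punits_mxunits.
have [i ik|c bc] := IH; first by apply: bB; exact: ltnW.
have [//|d bd] := bB k.
rewrite big_ord_recr /= bc bd; set P := psize n k.
(* The coefficients form the Kronecker product of the two coefficient matrices, with [d] on the top
   digit. *)
exists (fun i j => c (i %% P)%N (j %% P)%N * d (i %/ P)%N (j %/ P)%N).
rewrite psizeS -/P.
pose f i j := (c (i %% P)%N (j %% P)%N * d (i %/ P)%N (j %/ P)%N) *: punits n e k.+1 i j.
change (mxcomb P (punits n e k) c * mxcomb (n k).+1 (e k) d =
  \sum_(i < P * (n k).+1) \sum_(j < P * (n k).+1) f i j).
rewrite (sum_ord_mul _ _ (fun i => \sum_(j < P * (n k).+1) f i j)).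
rewrite mulr_suml; apply: eq_bigr => i _.
under [RHS]eq_bigr do rewrite (sum_ord_mul _ _ (f _)).
rewrite exchange_big mulr_suml; apply: eq_bigr => j _ /=.
rewrite /mxcomb mulr_sumr; apply: eq_bigr => t _.
rewrite mulr_sumr; apply: eq_bigr => s _.
rewrite /f !modn_add_mul // !divn_add_mul // punitsS ?leq_ord //.
by rewrite -scalerAl -scalerAr scalerA.
Qed.

(** The matrices of size [psize n k] serve as tensor product, [mu] sending elementary matrices to
    product units; a pure tensor is the preimage of the product in [A]. For universality, families
    of matrix units correspond to pairs of indices and go to elementary matrices, so a multilinear
    map has exactly one linear extension. *)
Lemma tensor_exists k :
  exists (T : tensorProduct (fun i : 'I_k => unit_span i)) (mu : {linear T -> A}),
  [/\ forall b, (forall i : 'I_k, unit_span i (b i)) ->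
        mu (tensor T b) = \prod_(i < k) b i,
      injective mu &
      range mu = [set mxcomb (psize n k) (punits n e k) c | c in [set: nat -> nat -> F]]].
Proof.
set P := psize n k; set v := punits n e k; set B := fun i : 'I_k => unit_span i.
have vv : mxunits P v by exact: punits_mxunits.
have [mu [muinj muc mur]] := mxunits_linear vv.
(* For families outside [B] the product need not be in the image of [mu], hence the default 0. *)
pose tn (b : 'I_k -> A) := xget 0 [set M | mu M = \prod_(i < k) b i].
have tnE b : (forall i, B i (b i)) -> mu (tn b) = \prod_(i < k) b i.
  (* [prod_unit_span] takes a family indexed by [nat], so [b] is extended by 0. *)
  move=> Bb; have [i ik|c bc] := @prod_unit_span k (fun i =>
    if insub i is Some j then b j else 0).
    by rewrite insubT; apply: (Bb (Ordinal ik)).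
  have {}bc : \prod_(i < k) b i = mxcomb P v c.
    by rewrite -bc; apply: eq_bigr => i _; rewrite valK.
  rewrite /tn; case: xgetP => // /(_ (\matrix_(i, j) c i j)) [] /=.
  by rewrite muc bc.
have updB b i x : (forall i, B i (b i)) -> B i x ->
    forall j, B j ([eta b with i |-> x] j).
  by move=> Bb Bx j /=; case: eqP => [->|].
have tnml : multilinear_on B tn.
  move=> b i a x y Bb Bx By; apply: muinj; rewrite linearP !tnE; first last.
  - by apply: updB => //; apply: unit_span_lin.
  - exact: updB.
  - exact: updB.
  exact: (prod_multilinear a Bb Bx By).
pose G (i : 'I_k) : set A :=
  [set x | exists a b, [/\ (a <= n i)%N, (b <= n i)%N & x = e i a b]].
have GB i : G i `<=` B i.
  by move=> _ [a [b [an bn ->]]]; eexists; apply/esym; exact: mxcomb_delta.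
have gen i x : B i x -> exists m (c : 'I_m -> F) (y : 'I_m -> A),
    (forall s, G i (y s)) /\ x = \sum_(s < m) c s *: y s.
  move=> [c ->]; exists #|{: 'I_(n i).+1 * 'I_(n i).+1}|.
  pose ev (s : 'I_#|{: 'I_(n i).+1 * 'I_(n i).+1}|) : 'I_(n i).+1 * 'I_(n i).+1 :=
    enum_val s.
  exists (fun s => c (ev s).1 (ev s).2), (fun s => e i (ev s).1 (ev s).2); split.
    by move=> s; exists (ev s).1, (ev s).2; rewrite !leq_ord.
  rewrite /mxcomb pair_big /= (reindex ev) //.
  exact/onW_bij/enum_val_bij.
pose dlt I J : 'M[F]_P := \matrix_(i, j) ((i == I :> nat) && (j == J :> nat))%:R.
pose pure I J : 'I_k -> A := fun i => e i (digit n i I) (digit n i J).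
have pureB I J i : B i (pure I J i).
  by apply: GB; exists (digit n i I), (digit n i J); rewrite !digit_le.
have tnd I J : (I < P)%N -> (J < P)%N -> tn (pure I J) = dlt I J.
  move=> IP JP; apply: muinj.
  by rewrite tnE // (muc (fun i j => ((i == I) && (j == J))%:R)) mxcomb_delta.
have pureP b : (forall i, G i (b i)) ->
    exists I J, [/\ (I < P)%N, (J < P)%N & b = pure I J].
  move=> Gb; have /choice[d dP] (i : nat) : exists d : nat * nat, forall ik : (i < k)%N,
      [/\ (d.1 <= n i)%N, (d.2 <= n i)%N & b (Ordinal ik) = e i d.1 d.2].
    have [ik|nik] := pselect (i < k)%N; last by exists (0, 0)%N.
    have [a [c [an cn bE]]] := Gb (Ordinal ik); exists (a, c) => ik'.
    by rewrite (bool_irrelevance ik' ik).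
  have [i ik|I IP Id] := @digits_onto n k (fun i => (d i).1); first by have [] := dP i ik.
  have [i ik|J JP Jd] := @digits_onto n k (fun i => (d i).2); first by have [] := dP i ik.
  exists I, J; split=> //; apply/funext => i; rewrite /pure Id // Jd //.
  by have [_ _ <-] := dP i (ltn_ord i); congr b; apply: val_inj.
have sumd (M : 'M[F]_P) : M = \sum_(i < P) \sum_(j < P) M i j *: dlt i j.
  rewrite [LHS]matrix_sum_delta; apply: eq_bigr => i _; apply: eq_bigr => j _.
  by congr (_ *: _); apply/matrixP => s t; rewrite !mxE.
have univ (W : lmodType F) (g : ('I_k -> A) -> W) : multilinear_on B g ->
    exists h : {linear 'M[F]_P -> W},
      (forall b, (forall i, B i (b i)) -> h (tn b) = g b) /\
      forall h' : {linear 'M[F]_P -> W},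
        (forall b, (forall i, B i (b i)) -> h' (tn b) = g b) -> h' =1 h.
  move=> gml.
  (* Each elementary matrix gets the value of [g] on the corresponding family of matrix units;
     [multilinear_on_ext] then gives agreement on all pure tensors. *)
  pose h (M : 'M[F]_P) : W := \sum_(i < P) \sum_(j < P) M i j *: g (pure i j).
  have hlin : linear h.
    move=> a M N; rewrite /h scaler_sumr -big_split; apply: eq_bigr => i _ /=.
    rewrite scaler_sumr -big_split; apply: eq_bigr => j _ /=.
    by rewrite !mxE scalerDl scalerA.
  pose hl := GRing.isLinear.Build F 'M[F]_P W *:%R h hlin.
  pose H : {linear 'M[F]_P -> W} := HB.pack h hl.
  have Hg b : (forall i, B i (b i)) -> H (tn b) = g b.
    apply: (@multilinear_on_ext _ _ _ _ _ G _ (H \o tn) g) => //.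
    - move=> i a x y; exact: unit_span_lin.
    - move=> c i a x y Bc Bx By; apply: etrans (congr1 H (tnml c i a x y Bc Bx By)) _.
      exact: (linearP H).
    - move=> c /pureP[I [J [IP JP ->]]] /=; rewrite tnd //.
      change (h (dlt I J) = g (pure I J)).
      rewrite /h -[RHS](sum_ord_pred1 (fun i => g (pure i J)) IP).
      apply: eq_bigr => i _; have [iI|iI] := eqVneq; last first.
        by rewrite big1 // => j _; rewrite !mxE (negPf iI) scale0r.
      rewrite -[RHS](sum_ord_pred1 (fun j => g (pure i j)) JP).
      apply: eq_bigr => j _; rewrite !mxE iI eqxx /=.
      by case: eqP; rewrite ?scale1r ?scale0r.
  exists H; split=> // h' h'g M; rewrite (sumd M) !linear_sum; apply: eq_bigr => i _.
  rewrite !linear_sum; apply: eq_bigr => j _; rewrite !linearZ_LR.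
  by congr (_ *: _); rewrite -tnd // Hg // h'g.
by exists (TensorProduct tnml univ), mu.
Qed.

(** [T] is an arbitrary tensor product, not the one built in [tensor_exists]. Both [mu] and the
    composite of [mu0] with the comparison map [h] induce the product map, so they agree by
    uniqueness. *)
Lemma tensor_range k (T : tensorProduct (fun i : 'I_k => unit_span i))
    (mu : {linear T -> A}) :
  (forall b, (forall i : 'I_k, unit_span i (b i)) ->
     mu (tensor T b) = \prod_(i < k) b i) ->
  forall t, exists c, mu t = mxcomb (psize n k) (punits n e k) c.
Proof.
move=> muT t; have [T0 [mu0 [mu0T _ mu0r]]] := tensor_exists k.
have [h [hT _]] := tensor_universal T (tensor_multilinear T0).
have [g [_ gU]] := tensor_universal T (prod_multilinear (B := fun i : 'I_k => unit_span i)).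
have muh : mu t = mu0 (h t).
  rewrite (gU mu muT) -(gU (mu0 \o h)) // => b Bb /=.
  by rewrite hT // mu0T.
have : range mu0 (mu t) by exists (h t).
by rewrite mu0r => -[c _ <-]; exists c.
Qed.

End TensorProducts.

(** * Cartan subalgebras *)

(* A nonzero row of each idempotent is fixed by it and killed by the others;
   these rows form the change of basis. *)
Lemma orthogonal_idempotents_diag (F : fieldType) n (M : 'I_n -> 'M[F]_n) :
  (forall j, M j != 0) -> (forall j, M j *m M j = M j) ->
  (forall i j, i != j -> M i *m M j = 0) ->
  exists2 P : 'M[F]_n, P \in unitmx & forall j, P *m M j = delta_mx j j *m P.
Proof.
move=> M0 MM MO.
have /choice[r rM] j : exists i, row i (M j) != 0.
  apply/not_existsP => rM; move/eqP: (M0 j); apply.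
  by apply/row_matrixP => i; rewrite row0; apply/eqP/negPn/negP; exact: rM.
pose P : 'M[F]_n := \matrix_j row (r j) (M j).
have rP j : row j P = row (r j) (M j) by rewrite rowK.
have PM k : P *m M k = delta_mx k k *m P.
  apply/row_matrixP => j; rewrite [LHS]row_mul rP -row_mul [RHS]row_mul.
  have -> : row j (delta_mx k k) = (j == k)%:R *: delta_mx 0 k :> 'rV[F]_n.
    by apply/rowP => l; rewrite !mxE eqxx /=; case: (j == k); rewrite ?mul1r ?mul0r.
  rewrite -scalemxAl -rowE; have [->|jk] := eqVneq j k.
    by rewrite MM scale1r rP.
  by rewrite MO // row0 scale0r.
exists P => //; rewrite -row_free_unit; apply: inj_row_free => v vP.
apply/rowP => k; rewrite mxE.
have : v *m P *m M k = 0 by rewrite vP mul0mx.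
rewrite -mulmxA PM mulmxA.
have -> : v *m delta_mx k k = v 0 k *: delta_mx 0 k.
  apply/rowP => l; rewrite !mxE (bigD1 k) //= big1 ?addr0 => [|i ik].
    by rewrite !mxE eqxx.
  by rewrite mxE (negPf ik) mulr0.
by rewrite -scalemxAl -rowE rP => /eqP; rewrite scaler_eq0 (negPf (rM k)) orbF => /eqP.
Qed.

(** If [P] diagonalises the idempotents, the conjugates [P^-1 * d i j * P] of the standard units are
    matrix units, and the diagonal ones among them are the given idempotents. *)
Lemma cartan_mxunits (F : fieldType) (A : algType F) n (B C : set A) :
  subalgebra_iso 'M[F]_n.+1 B -> matrix_cartan n.+1 B C ->
  exists e, [/\ mxunits n.+1 e, B = [set b | exists c, b = mxcomb n.+1 e c] &
    C = range (fun c : 'I_n.+1 -> F => \sum_(j < n.+1) c j *: e j j)].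
Proof.
move=> [_ [f [finj fB]]] [eps [epsB eps0 epsI epsO ->]].
have /choice[M fM] j : exists x, f x = eps j.
  by have := epsB j; rewrite -fB => -[x _ <-]; exists x.
have [j|j|i j ij|P Pu PM] := @orthogonal_idempotents_diag F n.+1 M.
- by apply: contra_neq (eps0 j) => Mj0; rewrite -fM Mj0 raddf0.
- by apply: finj; rewrite mulmxE rmorphM /= fM epsI.
- by apply: finj; rewrite mulmxE rmorphM /= !fM epsO // raddf0.
pose d (i j : nat) : 'M[F]_n.+1 := delta_mx (inord i) (inord j).
have Pu' : P \is a GRing.unit by [].
have dM i j k l : (j < n.+1)%N -> (k < n.+1)%N ->
    d i j * d k l = if j == k then d i l else 0.
  move=> jn kn; rewrite /d -mulmxE; case: eqP => [->|jk].
    by rewrite mul_delta_mx.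
  rewrite mul_delta_mx_0 //; apply: contra_not_neq jk => /(congr1 val) /=.
  by rewrite !inordK.
have conjM X Y : P^-1 * X * P * (P^-1 * Y * P) = P^-1 * (X * Y) * P.
  by rewrite !mulrA mulrK.
exists (fun i j => f (P^-1 * d i j * P)); split.
- split=> [i j k l iN jN kN lN|].
    rewrite -rmorphM conjM dM //.
    by case: eqP => _; rewrite // mulr0 mul0r raddf0.
  rewrite -(raddf_sum f) -mulr_suml -mulr_sumr.
  have -> : \sum_(i < n.+1) d i i = 1.
    rewrite -[1]/(1%:M) [RHS]mx1_sum_delta; apply: eq_bigr => i _.
    by rewrite /d inord_val.
  by rewrite mulr1 mulVr //; exact: rmorph1.
- rewrite -fB; apply/seteqP; split=> [_ [X _ <-]|b [c ->]].
    exists (fun i j => (P * X * P^-1) (inord i) (inord j)).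
    have {1}-> : X = P^-1 * (P * X * P^-1) * P by rewrite !mulrA mulVr // mul1r mulrVK.
    set Y := P * X * P^-1; rewrite {1}(matrix_sum_delta Y).
    rewrite mulr_sumr mulr_suml raddf_sum; apply: eq_bigr => i _ /=.
    rewrite mulr_sumr mulr_suml raddf_sum; apply: eq_bigr => j _ /=.
    by rewrite !inord_val -scalerAr -scalerAl linearZ_LR /d !inord_val.
  exists (\sum_(i < n.+1) \sum_(j < n.+1) c i j *: (P^-1 * d i j * P)) => //.
  rewrite raddf_sum; apply: eq_bigr => i _ /=.
  by rewrite raddf_sum; apply: eq_bigr => j _ /=; rewrite linearZ_LR.
apply: (congr1 (fun g : ('I_n.+1 -> F) -> A => range g)).
apply/funext => c; apply: eq_bigr => j _; congr (_ *: _).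
rewrite -fM; congr (f _); apply: (mulrI Pu'); rewrite !mulrA mulrV // mul1r.
by rewrite /d inord_val -mulmxE PM.
Qed.

Lemma cartan_matrix_system (F : fieldType) (A : algType F) (H : set A) :
  cartan_subalgebra H ->
  exists D u, @matrix_system F D A u /\ H = dgspan D u.
Proof.
move=> [n [B [C [[iso Bcomm [T [mu [muT _ muS]]]] CB ->]]]].
have /choice[e eP] i := cartan_mxunits (iso i) (CB i).
have BE : B = unit_span n e by apply/funext => i; have [] := eP i.
have CE : C = unit_diag n e by apply/funext => i; have [] := eP i.
have e_units i : mxunits (n i).+1 (e i) by have [] := eP i.
subst B C; have eB i a b : (a <= n i)%N -> (b <= n i)%N -> unit_span n e i (e i a b).
  by move=> an bn; eexists; apply/esym/mxcomb_delta.
have e_comm i j a b c d : i != j -> (a <= n i)%N -> (b <= n i)%N ->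
    (c <= n j)%N -> (d <= n j)%N -> e i a b * e j c d = e j c d * e i a b.
  by move=> ij an bn cn dn; apply: (Bcomm i j) => //; exact: eB.
have [u [uu ucoh uv]] := product_units e_units e_comm.
exists (divisors_of (psize n)), u; split; last exact: generated_diag.
split=> // [|a]; first exact: dirset_psize.
have : product_span n e a.
  have [k [t _ <-]] := muS a.
  (* [T k] has the factors [0], ..., [k], so the image of [mu k] lies at level [k.+1]. *)
  have [c ->] := tensor_range e_units e_comm (muT k) t.
  by exists k.+1, c.
by rewrite (product_mxspan ucoh uv).
Qed.

(** * The Hamming system of the idempotents of a Cartan subalgebra *)

Section IdempotentSystem.
Variables (R : realType) (F : fieldType) (A : algType F) (H : set A).
Variables (hC : comm_subalgebra H) (Alm : locally_matrix A).
Variables (D : set nat) (u : nat -> nat -> nat -> A).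
Hypothesis sys : matrix_system D u.
Hypothesis HE : H = dgspan D u.
Notation E := (idempotent_space hC R Alm).

Lemma idem_val0 : idem_val (0 : idempotents hC) = 0. Proof. by []. Qed.
(** The Boolean sum of two idempotents with product 0 is their sum in [A], and a partial sum stays
    orthogonal to the next term. *)
Lemma idem_val_sum m (y : nat -> idempotents hC) :
  (forall i j, (i < m)%N -> (j < m)%N -> i != j -> idem_val (y i) * idem_val (y j) = 0) ->
  idem_val (\sum_(i < m) y i) = \sum_(i < m) idem_val (y i).
Proof.
elim: m => [|m IH] yO; first by rewrite !big_ord0.
have {}IH : idem_val (\sum_(i < m) y i) = \sum_(i < m) idem_val (y i).
  by apply: IH => i j im jm; apply: yO; exact: ltnW.
rewrite !big_ord_recr /= idem_valD IH (_ : _ * _ = 0) ?mul0rn ?subr0 //.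
rewrite mulr_suml big1 // => i _.
by apply: yO; rewrite ?ltnS ?(ltnW (ltn_ord i)) // neq_ltn ltn_ord.
Qed.

(** The diagonal units have relative rang [1 / N]. An idempotent in their span has coefficients with
    [c i * c i = c i], that is 0 or 1 in the field, hence is a combination over ['F_2]. *)
Lemma idem_hamming_system : exists x, hamming_system D (S := E) x.
Proof.
have [Ddir uu ucoh _] := sys; have [_ Dpos _ _] := Ddir.
have ud N i j : D N -> (i < N)%N -> (j < N)%N ->
    u N i i * u N j j = if i == j then u N i i else 0 by exact: mxunits_diag.
have /choice[x xE] (p : nat * nat) : exists y : idempotents hC,
    D p.1 -> (p.2 < p.1)%N -> idem_val y = u p.1 p.2 p.2.
  case: p => N i /=; have [[DN iN]|nD] := pselect (D N /\ (i < N)%N); last first.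
    by exists 0 => DN iN; case: nD.
  have uH : H (u N i i).
    rewrite HE; exists N, (fun j => (j == i)%:R); split=> //.
    rewrite -[LHS](sum_ord_pred1 (fun j => u N j j) iN).
    by apply: eq_bigr => j _; case: eqP; rewrite ?scale1r ?scale0r.
  have uI : u N i i * u N i i = u N i i by rewrite ud // eqxx.
  by exists (mk_idem hC uH uI).
have {}xE N i : D N -> (i < N)%N -> idem_val (x (N, i)) = u N i i by exact: (xE (N, i)).
have xO N i j : D N -> (i < N)%N -> (j < N)%N -> i != j ->
    idem_val (x (N, i)) * idem_val (x (N, j)) = 0.
  by move=> DN iN jN ij; rewrite !xE // ud // (negPf ij).
exists (fun N i => x (N, i)); split=> //.
- move=> N DN; split=> [i iN|i j iN jN ij|].
  + rewrite /= /rang /= /idem_rang xE //.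
    have uN := uu _ DN; have := Dpos _ DN.
    move: DN iN uN; case: N => // m DN im uN _.
    have [f [finj fE]] := mxunits_morphism uN.
    have <- : f (delta_mx (inord i) (inord i)) = u m.+1 i i.
      rewrite fE -(mxcomb_delta (u m.+1) im im); apply: eq_bigr => k _.
      by apply: eq_bigr => l _; rewrite !mxE -!val_eqE /= !inordK.
    by rewrite relative_rangE // mxrank_delta mul1r.
  + by apply: idem_val_inj; rewrite [LHS]xO.
  + apply: idem_val_inj; apply: etrans (idem_val_sum (y := fun i => x (N, i)) _) _.
      by move=> i j; exact: xO.
    by rewrite -[RHS](uu _ DN).2; apply: eq_bigr => i _; exact: xE.
- move=> a b Db ab i _ ia _; have Da : D a by have [_ _ _ Ddown] := Ddir; exact: Ddown ab.
  have tb t : (t < b %/ a)%N -> (i + t * a < b)%N.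
    by move=> tq; rewrite -[ltnRHS](divnK ab) [ltnRHS]mulnC ltn_add_mul.
  apply: idem_val_inj.
  apply: etrans _ (esym (idem_val_sum (y := fun t => x (b, (i + t * a)%N)) _)).
    rewrite xE // (ucoh _ _ Db ab) //; apply: eq_bigr => t _.
    by rewrite xE // tb.
  move=> t s tq sq ts; apply: xO; rewrite ?tb // eqn_add2l eqn_mul2r negb_or ts andbT -lt0n.
  exact: Dpos.
move=> e; have /set_mem[] := valP e; rewrite {1}HE => -[N [c [DN ec]]] ee.
have uN := uu _ DN.
(* Read as matrices, diagonal combinations have unique coefficients by [mxcomb_inj]. *)
have lm c' : lcomb N (fun i => u N i i) c' =
    mxcomb N (u N) (fun i j => if j == i then c' i else 0).
  apply: eq_bigr => i _; rewrite -[LHS](sum_ord_pred1 (fun j => c' i *: u N i j) (ltn_ord i)).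
  by apply: eq_bigr => j _; case: eqP; rewrite ?scale0r.
have cc i : (i < N)%N -> c i * c i = c i.
  move=> iN; move: ee; rewrite ec lcomb_mul; last by move=> *; exact: ud.
  by rewrite !lm => /(mxcomb_inj uN)/(_ iN iN); rewrite eqxx.
pose d i : 'F_2 := if c i == 1 then 1 else 0.
have dx i : (i < N)%N -> idem_val (d i *: x (N, i)) = c i *: u N i i.
  move=> iN; rewrite /d; case: eqP => [->|c1].
    by rewrite !scale1r xE.
  have /eqP: c i * (c i - 1) = 0 by rewrite mulrBr cc // mulr1 subrr.
  rewrite mulf_eq0 subr_eq0 (introF eqP c1) orbF => /eqP->.
  by rewrite !scale0r idem_val0.
exists N, d; split=> //; apply: idem_val_inj.
apply: etrans _ (esym (idem_val_sum (y := fun i => d i *: x (N, i)) _)).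
  by rewrite [LHS]ec; apply: eq_bigr => i _; rewrite dx.
by move=> i j iN jN ij; rewrite !dx // -scalerAl -scalerAr ud // (negPf ij) !scaler0.
Qed.

End IdempotentSystem.

(** * Exhausting a locally standard Hamming space *)

Lemma standard_subspace_hunits (R : realType) (S : hammingSpace R) n (T : set S) :
  hamming_subspace_iso (standard_hamming R n) T ->
  exists2 y, hunits n.+1 y & forall a, T a -> exists c, a = lcomb n.+1 y c.
Proof.
move=> [_ [f [_ <- fr]]].
exists (fun i => f (cube_delta (inord i))); first exact: morphism_hunits fr (hunits_cube R n).
move=> _ [a _ <-]; exists (fun i => a (inord i)).
rewrite {1}(cube_sum a) raddf_sum; apply: eq_bigr => i _.
by rewrite inord_val /= linearZ_LR.
Qed.

(** The coefficients [c i] are the indicator of the set [J i] of those [j] for which [y j] lies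
    below [x i]. Comparing rangs, each [J i] has [m %/ N] elements, and the [J i] are disjoint.
    Renumbering [y] so that the [t]-th element of [J i] gets the number [i + t * N] gives the
    coherent refinement. *)
Lemma hunits_refine (R : realType) (S : hammingSpace R) N (x : nat -> S) m y c :
  hunits N x -> hunits m y -> (forall i, (i < N)%N -> x i = lcomb m y (c i)) ->
  (N %| m)%N /\ exists x', [/\ hunits m x',
    forall i, (i < N)%N -> x i = \sum_(t < m %/ N) x' (i + t * N)%N &
    forall d, exists d', lcomb m y d = lcomb m x' d'].
Proof.
move=> xx yy xE; have N0 := hunits_gt0 xx; have m0 := hunits_gt0 yy.
pose J i := [seq j <- iota 0 m | c i j == 1].
have memJ i j : (j \in J i) = (c i j == 1) && (j < m)%N.
  by rewrite mem_filter mem_iota.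
have sumJ (V : nmodType) i (g : nat -> V) :
    \sum_(j <- J i) g j = \sum_(j < m) (if c i j == 1 then g j else 0).
  rewrite big_filter big_mkcond /=.
  by rewrite -(big_mkord xpredT (fun j => if c i j == 1 then g j else 0)) /index_iota subn0.
have sizeJ i : (i < N)%N -> (size (J i) * N = m)%N.
  move=> iN; have [/(_ i iN) + _ _] := xx; rewrite xE // rang_lcomb // => /eqP.
  rewrite -[X in _ == X]mul1r eqr_div ?pnatr_eq0 -?lt0n // mul1r -natrM eqr_nat.
  move=> /eqP <-; congr (_ * _)%N; rewrite -sum1_size sumJ; apply: eq_bigr => j _.
  by case: (F2P (c i j)) => ->.
have Nm : (N %| m)%N by rewrite -(sizeJ _ N0) dvdn_mull.
split=> //; set q := (m %/ N)%N.
have mE : m = (N * q)%N by rewrite mulnC divnK.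
have {}sizeJ i : (i < N)%N -> size (J i) = q.
  by move=> iN; rewrite /q -{1}(sizeJ _ iN) mulnK.
pose s l := nth 0%N (J (l %% N)%N) (l %/ N)%N.
have lt1 l : (l %% N < N)%N by rewrite ltn_mod.
have lt2 l : (l < m)%N -> (l %/ N < q)%N by rewrite ltn_divLR // mulnC -mE.
have sJ l : (l < m)%N -> s l \in J (l %% N)%N.
  by move=> lm; apply: mem_nth; rewrite sizeJ // lt2.
have sm l : (l < m)%N -> (s l < m)%N by move=> /sJ; rewrite memJ => /andP[].
(* A common element of [J i] and [J i'] would have coefficient 1 in the product [x i * x i'], which
   is 0. *)
have disj i i' j : (i < N)%N -> (i' < N)%N -> j \in J i -> j \in J i' -> i = i'.
  move=> iN iN'; rewrite !memJ => /andP[/eqP cij jm] /andP[/eqP cij' _].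
  apply/eqP/negPn/negP => ii'; have [_ xo _] := xx.
  have := xo _ _ iN iN' ii'; rewrite !xE // lcomb_mul; last first.
    exact: (hunits_mul yy).
  move=> e0; have : lcomb m y (fun k => c i k * c i' k) = lcomb m y (fun=> 0).
    by rewrite e0; apply/esym/big1 => k _; rewrite scale0r.
  by move=> /(lcomb_inj yy)/(_ jm); rewrite cij cij' mulr1 => /eqP; rewrite oner_eq0.
have sinj l l' : (l < m)%N -> (l' < m)%N -> s l = s l' -> l = l'.
  move=> lm lm' ss; have ll' : (l %% N = l' %% N)%N.
    by apply: (disj _ _ _ (lt1 l) (lt1 l') (sJ l lm)); rewrite ss; exact: sJ.
  rewrite (divn_eq l N) (divn_eq l' N) ll'; congr (_ * _ + _)%N.
  move: ss; rewrite /s ll' => /eqP; rewrite nth_uniq ?sizeJ ?lt2 //.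
    by move/eqP.
  by rewrite filter_uniq ?iota_uniq.
have m1 : m.-1.+1 = m by exact: prednK.
pose sg (l : 'I_m) : 'I_m := Ordinal (sm l (ltn_ord l)).
have sgbij : bijective sg.
  by apply: injF_bij => l l' /(congr1 val) /= /sinj ss; apply: val_inj; apply: ss.
have [yr yo y1] := yy.
exists (y \o s); split.
- split=> [l lm|l l' lm lm' ll'|] /=.
  + by rewrite yr // sm.
  + by apply: yo; rewrite ?sm //; apply: contra_neq ll' => /sinj; exact.
  + by rewrite -y1 [RHS](reindex sg) //; exact: onW_bij.
- move=> i iN; rewrite xE //.
  have -> : lcomb m y (c i) = \sum_(j <- J i) y j.
    rewrite sumJ; apply: eq_bigr => j _.
    by case: (F2P (c i j)) => ->; rewrite ?scale0r ?scale1r.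
  rewrite (big_nth 0%N) big_mkord sizeJ //; apply: eq_bigr => t _ /=.
  by rewrite /s modn_add_mul // divn_add_mul.
- move=> d; exists (d \o s); rewrite /lcomb [LHS](reindex sg) //.
  exact: onW_bij.
Qed.

(** Along an enumeration of [S], each step takes a standard subspace containing the current
    partition and the next element, and renumbers its atoms by [hunits_refine]. Every element is
    reached because the enumeration is onto. *)
Lemma locally_standard_chain (R : realType) (S : hammingSpace R) :
  [set: S] #= [set: nat] -> locally_standard S ->
  exists p x, [/\ p 0%N = 1%N, forall k, (p k %| p k.+1)%N &
    hamming_system (S := S) (divisors_of p) x].
Proof.
move=> Snat Sls.
have [en enP] : exists en : nat -> S, forall s, exists k, en k = s.
  have /card_set_bijP[f [_ finj _]] := Snat.
  exists (fun k => xget 0 [set s | f s = k]) => s; exists (f s).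
  case: xgetP => [t _ fts|/(_ s)/(_ erefl)] //.
  by apply: finj => //; exact: mem_set.
(* A state is a size with a family; only states satisfying [hunits] are refined, the others get an
   arbitrary successor. *)
have /choice[nx nxP] (st : (nat * (nat -> S)) * S) : exists st' : nat * (nat -> S),
    hunits st.1.1 st.1.2 -> [/\ (st.1.1 %| st'.1)%N, hunits st'.1 st'.2,
      forall i, (i < st.1.1)%N ->
        st.1.2 i = \sum_(t < st'.1 %/ st.1.1) st'.2 (i + t * st.1.1)%N &
      exists c, st.2 = lcomb st'.1 st'.2 c].
  case: st => -[N x] s /=; have [xx|nxx] := pselect (hunits N x); last by exists (0%N, x).
  have [n [T [Tstd inT]]] := Sls (s :: [seq x i | i <- iota 0 N]).
  have [y yy yT] := standard_subspace_hunits Tstd.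
  have /choice[c cP] i : exists c, (i < N)%N -> x i = lcomb n.+1 y c.
    have [iN|niN] := pselect (i < N)%N; last by exists (fun=> 0).
    have [|c ->] := yT (x i); last by exists c.
    by apply: inT; rewrite inE map_f ?orbT // mem_iota.
  have [Nm [x' [xx' xx'E xx'c]]] := hunits_refine xx yy cP.
  have [|d sd] := yT s; first by apply: inT; rewrite mem_head.
  exists (n.+1, x') => _; split=> //=.
  by have [d' dd'] := xx'c d; exists d'; rewrite sd.
(* The start is the partition of 1 into a single part; its size 1 matches the empty product
   [psize n 0]. *)
pose st := fix st k := if k is k'.+1 then nx (st k', en k') else (1%N, fun=> 1 : S).
have sth k : hunits (st k).1 (st k).2.
  elim: k => [|k IH] /=; last by have [] := nxP (st k, en k) IH.
  split=> [i _|i j|]; last by rewrite big_ord1.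
    by rewrite invr1; apply/rang_eq1.
  by rewrite !ltnS !leqn0 => /eqP-> /eqP->.
exists (fun k => (st k).1); have stP k := nxP (st k, en k) (sth k).
have [x xsys] : exists x, @hamming_system R (divisors_of (fun k => (st k).1)) S x.
  apply: (@chain_hamming_system _ _ _ (fun k => (st k).2)) => // [k|k i ik|s].
  - by have [] := stP k.
  - by have [_ _ + _] := stP k; apply.
  - have [k <-] := enP s; exists k.+1.
    by have [_ _ _ [c]] := stP k; exists c.
by exists x; split=> // k; have [] := stP k.
Qed.

(** If [D] were bounded, directedness would make its largest element [M] a multiple of all the
    others. Every element of [S] would then be a combination over ['F_2] of the [M] units of that
    size, and [S] would be finite. *)
Lemma hamming_system_unbounded (R : realType) (S : hammingSpace R) D x :
  [set: S] #= [set: nat] -> @hamming_system R D S x ->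
  forall m, exists2 N, D N & (m < N)%N.
Proof.
move=> Snat [Ddir xx coh full] m; have [[N0 DN0] Dpos Dcup _] := Ddir.
apply: contrapT => nD.
have Dm N : D N -> (N <= m)%N.
  by move=> DN; rewrite leqNgt; apply/negP => mN; apply: nD; exists N.
have exD : exists N, `[< D N >] by exists N0; apply/asboolP.
have leD N : `[< D N >] -> (N <= m)%N by move=> /asboolP; exact: Dm.
have [M /asboolP DM maxM] := ex_maxnP exD leD.
have dvM N : D N -> (N %| M)%N.
  move=> DN; have [P DP [NP MP]] := Dcup _ _ DN DM.
  have PM : (P <= M)%N by apply: maxM; apply/asboolP.
  suff -> : M = P by [].
  by apply/eqP; rewrite eqn_leq PM andbT dvdn_leq // Dpos.
have fin : finite_set [set: S].
  have -> : [set: S] = range (fun c : {ffun 'I_M -> 'F_2} => \sum_(i < M) c i *: x M i).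
    apply/seteqP; split=> // a _; have [N [c [DN ->]]] := full a.
    rewrite (lcomb_lift c Ddir coh DM (dvM _ DN)).
    by exists [ffun i : 'I_M => c (i %% N)%N] => //; apply: eq_bigr => i _; rewrite ffunE.
  exact/finite_image/finite_finset.
by apply: infinite_nat; rewrite -(eq_finite_set Snat).
Qed.

(** * Construction of the algebra *)

Section Subalgebra.
Variables (F : fieldType) (A : algType F) (E : set A).
Hypothesis Ecl : GRing.subalg_closed [in E].

(** The closure proof is a parameter of the type so that the algebra structure can depend on it. *)
Definition subalg_of of GRing.subalg_closed [in E] : Type := {x : A | x \in E}.

HB.instance Definition _ := SubChoice.on (subalg_of Ecl).
HB.instance Definition _ :=
  GRing.SubChoice_isSubAlgebra.Build F A [in E] (subalg_of Ecl) Ecl.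
End Subalgebra.

Section Endomorphisms.
Variables (F : fieldType) (X : Type) (x0 : X).
Notation V := (X -> F^o).

(* The point [x0] only serves to make the ring nontrivial. *)
Definition fun_end of X : Type := {T : V -> V | `[< linear T >]}.
Notation E := (fun_end x0).

HB.instance Definition _ := SubChoice.on E.

Fact fun_end_closed : GRing.submod_closed [pred T : V -> V | `[< linear T >]].
Proof.
split=> [|a S T].
  by apply/asboolP => b x y; rewrite scaler0 addr0.
move=> /asboolP Slin /asboolP Tlin; apply/asboolP => b x y.
change (a *: S (b *: x + y) + T (b *: x + y) =
  b *: (a *: S x + T x) + (a *: S y + T y)).
rewrite Slin Tlin !scalerDr !scalerA [a * b]mulrC -!addrA; congr (_ + _).
by rewrite addrCA.
Qed.

HB.instance Definition _ :=
  GRing.SubChoice_isSubLmodule.Build F (V -> V) _ E fun_end_closed.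

Definition end_fun (T : E) : V -> V := val T.
Definition mk_end (T : V -> V) (Tlin : linear T) : E := exist _ T (asboolT Tlin).

Lemma end_fun_linear (T : E) : linear (end_fun T).
Proof. exact/asboolP/(valP T). Qed.

Fact end_id_linear : linear (@id V). Proof. by []. Qed.

Fact end_comp_linear (S T : E) : linear (end_fun S \o end_fun T).
Proof. by move=> a x y /=; rewrite !end_fun_linear. Qed.

Definition end_one : E := mk_end end_id_linear.
Definition end_mul (S T : E) : E := mk_end (end_comp_linear S T).

Fact end_mulA : associative end_mul. Proof. by move=> S T U; apply: val_inj. Qed.
Fact end_mul1l : left_id end_one end_mul. Proof. by move=> S; apply: val_inj. Qed.
Fact end_mul1r : right_id end_one end_mul. Proof. by move=> S; apply: val_inj. Qed.
Fact end_mulDl : left_distributive end_mul +%R.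
Proof. by move=> S T U; apply: val_inj. Qed.
Fact end_mulDr : right_distributive end_mul +%R.
Proof.
move=> S T U; apply: val_inj; apply/funext => f.
change (end_fun S (end_fun T f + end_fun U f) =
  end_fun S (end_fun T f) + end_fun S (end_fun U f)).
by have := end_fun_linear S 1 (end_fun T f) (end_fun U f); rewrite !scale1r.
Qed.
Fact end_one_neq0 : end_one != 0.
Proof.
apply/eqP => /(congr1 end_fun)/(congr1 (fun S : V -> V => S (fun=> 1) x0)).
by move/eqP; rewrite oner_eq0.
Qed.

HB.instance Definition _ := GRing.Zmodule_isNzRing.Build E
  end_mulA end_mul1l end_mul1r end_mulDl end_mulDr end_one_neq0.

Fact end_scalerAl (a : F) (S T : E) : a *: (S * T) = (a *: S) * T.
Proof. by apply: val_inj. Qed.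
HB.instance Definition _ := GRing.Lmodule_isLalgebra.Build F E end_scalerAl.

Fact end_scalerAr (a : F) (S T : E) : a *: (S * T) = S * (a *: T).
Proof.
apply: val_inj; apply/funext => f.
change (a *: end_fun S (end_fun T f) = end_fun S (a *: end_fun T f)).
have S0 : end_fun S 0 = 0.
  by have := end_fun_linear S (-1) 0 0; rewrite !scaleN1r !addNr.
by have := end_fun_linear S a (end_fun T f) 0; rewrite S0 !addr0.
Qed.
HB.instance Definition _ := GRing.Lalgebra_isAlgebra.Build F E end_scalerAr.

Lemma end_fun_sum m (T : 'I_m -> E) f x :
  end_fun (\sum_(i < m) T i) f x = \sum_(i < m) end_fun (T i) f x.
Proof.
elim: m T => [|m IH] T; first by rewrite !big_ord0.
by rewrite !big_ord_recr /= -IH.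
Qed.

End Endomorphisms.

Section DigitUnits.
Variables (F : fieldType) (n : nat -> nat).
Notation X := (forall i, 'I_(n i).+1).
Let x0 : X := fun i => ord0.

(* The matrix unit [E_ab] of the [i]-th coordinate. *)
Definition digit_op i a b (f : X -> F^o) : X -> F^o := fun x =>
  if x i == inord a then f (eqtype.dfwith x (inord b : 'I_(n i).+1)) else 0.

Fact digit_op_linear i a b : linear (digit_op i a b).
Proof.
move=> k f g; apply/funext => x; rewrite /digit_op.
change ((if x i == inord a then k *: f (eqtype.dfwith x (inord b : 'I_(n i).+1)) +
    g (eqtype.dfwith x (inord b : 'I_(n i).+1)) else 0) =
  k *: digit_op i a b f x + digit_op i a b g x).
by rewrite /digit_op; case: eqP => // _; rewrite scaler0 addr0.
Qed.

Definition digit_unit i a b : fun_end F x0 := mk_end x0 (@digit_op_linear i a b).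

(** Overwriting a coordinate twice keeps the last value, which gives the product rule. In the sum of
    the diagonal units, evaluated at [x], only [a = x i] survives, and it overwrites [x i] by
    itself. *)
Lemma digit_unit_mxunits i : mxunits (n i).+1 (digit_unit i).
Proof.
have dd (x : X) (a b : 'I_(n i).+1) : eqtype.dfwith (eqtype.dfwith x a) b = eqtype.dfwith x b.
  apply: functional_extensionality_dep => j.
  by case: eqtype.dfwithP => [|j' ij]; rewrite ?eqtype.dfwith_in // !eqtype.dfwith_out.
split=> [a b c d aN bN cN dN|].
  apply: val_inj; apply/funext => f; apply/funext => x.
  change (digit_op i a b (digit_op i c d f) x =
    val (if b == c then digit_unit i a d else 0) f x).
  rewrite /digit_op eqtype.dfwith_in dd.
  rewrite (_ : (inord b == inord c :> 'I_(n i).+1) = (b == c)); last first.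
    by rewrite -val_eqE /= !inordK.
  by case: (b == c) => //; case: (x i == inord a).
apply: val_inj; apply/funext => f; apply/funext => x.
change (end_fun (\sum_(a < (n i).+1) digit_unit i a a) f x = f x).
rewrite end_fun_sum (bigD1 (x i)) //= big1 ?addr0.
  rewrite /end_fun /= /digit_op inord_val eqxx; congr f.
  apply: functional_extensionality_dep => j.
  by case: eqtype.dfwithP.
move=> a ax; rewrite /end_fun /= /digit_op inord_val.
by rewrite eq_sym (negPf ax).
Qed.

(** Testing and overwriting one coordinate does not interfere with another coordinate. *)
Lemma digit_unit_comm i j a b c d : i != j ->
  digit_unit i a b * digit_unit j c d = digit_unit j c d * digit_unit i a b.
Proof.
move=> ij; apply: val_inj; apply/funext => f; apply/funext => x.
change (digit_op i a b (digit_op j c d f) x = digit_op j c d (digit_op i a b f) x).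
rewrite /digit_op eqtype.dfwith_out // eqtype.dfwith_out 1?eq_sym //.
case: ifP => xi; case: ifP => xj //; congr f.
apply: functional_extensionality_dep => k; have [jk|jk] := eqVneq j k.
  by case: k / jk; rewrite eqtype.dfwith_in eqtype.dfwith_out // eqtype.dfwith_in.
have [ik|ik] := eqVneq i k; last by rewrite !eqtype.dfwith_out.
by case: k / ik jk => ji; rewrite eqtype.dfwith_out // !eqtype.dfwith_in.
Qed.

End DigitUnits.

(** * Decomposition, Cartan subalgebra and dimension of the product algebra *)

Section FullProduct.
Variables (F : fieldType) (A : algType F) (n : nat -> nat).
Variable e : nat -> nat -> nat -> A.
Hypothesis e_units : forall i, mxunits (n i).+1 (e i).
Hypothesis e_comm : forall i j a b c d, i != j -> (a <= n i)%N -> (b <= n i)%N ->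
  (c <= n j)%N -> (d <= n j)%N -> e i a b * e j c d = e j c d * e i a b.
Hypothesis full : forall a, product_span n e a.
Notation P := (psize n).
Notation v := (punits n e).

Lemma unit_span_iso i : subalgebra_iso 'M[F]_((n i).+1) (unit_span n e i).
Proof.
have [f [finj fE]] := mxunits_morphism (e_units i).
have <- : range f = unit_span n e i; last first.
  by split; [exact: lrmorphism_range_closed|exists f].
apply/seteqP; split=> [_ [M _ <-]|_ [c ->]].
  exists (fun a b => M (inord a) (inord b)); rewrite fE.
  by apply: eq_bigr => a _; apply: eq_bigr => b _; rewrite !inord_val.
exists (\matrix_(a < (n i).+1, b < (n i).+1) c a b) => //; rewrite fE.
by apply: eq_bigr => a _; apply: eq_bigr => b _; rewrite mxE.
Qed.

Lemma unit_span_decomposition : matrix_decomposition n (unit_span n e).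
Proof.
split=> [i|i j ij _ _ [c ->] [d ->]|]; first exact: unit_span_iso.
  have commZ (k : F) (x y : A) : GRing.comm x y -> GRing.comm x (k *: y).
    by move=> xy; rewrite /GRing.comm -scalerAr -scalerAl xy.
  apply: commr_sum => a _; apply: commr_sum => b _; apply/commZ/commr_sym.
  apply: commr_sum => k _; apply: commr_sum => l _; apply/commZ/commr_sym.
  by apply: e_comm; rewrite ?leq_ord.
pose Tex k := cid (tensor_exists e_units e_comm k.+1).
pose T k := projT1 (Tex k); pose mu k := projT1 (cid (projT2 (Tex k))).
have muP k := projT2 (cid (projT2 (Tex k))).
exists T, mu; split=> [k|k|a]; [by have [] := muP k|by have [] := muP k|].
have [u [uu ucoh uv]] := product_units e_units e_comm.
have [k [c ac]] := full a; exists k; have [_ _ ->] := muP k.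
(* The coefficients are lifted by one level, because [mu k] involves [k.+1] factors. *)
exists (lift_coef (P k) c) => //; rewrite ac.
have Pk : (P k %| P k.+1)%N by exact: psize_dvdS.
have uvc l d : mxcomb (P l) (u (P l)) d = mxcomb (P l) (v l) d.
  by apply: eq_bigr => i _; apply: eq_bigr => j _; rewrite uv.
rewrite -!uvc; apply/esym.
exact: (mxcomb_lift c (dirset_psize n) ucoh (divisors_of_psize n k.+1) Pk).
Qed.

Lemma unit_diag_cartan :
  cartan_subalgebra (generated_subalgebra (\bigcup_i unit_diag n e i)).
Proof.
exists n, (unit_span n e), (unit_diag n e); split=> //.
  exact: unit_span_decomposition.
move=> i; have [eM _] := e_units i; exists (fun j : 'I_(n i).+1 => e i j j).
split=> // [j|j|j|j k jk].
- by eexists; apply/esym/mxcomb_delta.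
- exact: (mxunits_neq0 (e_units i)).
- by rewrite eM // eqxx.
- by rewrite eM // val_eqE (negPf jk).
Qed.

Hypothesis P_unbounded : forall m, exists k, (m < P k)%N.

(** The basis takes for each pair [(i, j)] the unit at the least level at which both indices are in
    range; pairs are enumerated by a bijection with [nat]. *)
Lemma product_countably_infinite_dim : countably_infinite_dim A.
Proof.
have [u [uu ucoh uv]] := product_units e_units e_comm.
have P_le k l : (k <= l)%N -> (P k <= P l)%N.
  by move=> kl; rewrite dvdn_leq ?psize_gt0 ?psize_dvd.
have exlev i j : exists k, ((i < P k) && (j < P k))%N.
  have [k] := P_unbounded (maxn i j); rewrite gtn_max => ijk.
  by exists k.
pose lev i j := ex_minn (exlev i j).
have levP i j k : (lev i j <= k)%N = ((i < P k) && (j < P k))%N.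
  rewrite /lev; case: ex_minnP => l /andP[il jl] lmin.
  apply/idP/idP => [lk|]; last exact: lmin.
  by rewrite !(leq_trans _ (P_le _ _ lk)).
pose bas i j := v (lev i j) i j.
have [pi pi_bij] : exists pi : nat -> nat * nat, bijective pi.
  have /card_esym/card_set_bijP[f fbij] := card_nat2.
  by exists f; rewrite -setTT_bijective.
exists (fun s => bas (pi s).1 (pi s).2); split=> [m c c0 s0|a].
  apply: contrapT => /eqP cs0.
  (* Among the nonzero coefficients one with the least row index [i] is chosen; the sandwich by
     diagonal units below then isolates it. *)
  case: (@arg_minnP _ s0 (fun s => c s != 0) (fun s : 'I_m => (pi s).1) cs0) => s cs smin.
  set i := (pi s).1 in smin; set j := (pi s).2.
  pose L := \max_(t < m) lev (pi t).1 (pi t).2.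
  have levL (t : 'I_m) : (lev (pi t).1 (pi t).2 <= L)%N.
    by rewrite /L (bigD1 t) //= leq_maxl.
  have /andP[iL jL] : ((i < P L) && (j < P L))%N by rewrite -levP; exact: (levL s).
  have uL := uu _ (divisors_of_psize n L).
  (* At level [L] a basis element is the sum of the units shifted by the multiples of [P l]. Since
     [i <= i'], every proper shift has row index above [i], so only the block 0 can survive. *)
  have basE i' j' : (lev i' j' <= L)%N -> (i <= i')%N ->
      u (P L) i i * bas i' j' * u (P L) j j =
      if (i' == i) && (j' == j) then u (P L) i j else 0.
    move=> l'L ii'; have := leqnn (lev i' j'); rewrite {1}levP => /andP[il' jl'].
    rewrite /bas; set l := lev i' j' in l'L il' jl' *.
    have PlL := psize_dvd n l'L; have q0 : (0 < P L %/ P l)%N.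
      by rewrite divn_gt0 ?psize_gt0 // P_le.
    have lt t x : (x < P l)%N -> (t < P L %/ P l)%N -> (x + t * P l < P L)%N.
      by move=> xl tq; rewrite -[ltnRHS](divnK PlL) [ltnRHS]mulnC ltn_add_mul.
    rewrite -uv // (ucoh _ _ (divisors_of_psize n L) PlL) //.
    rewrite mulr_sumr mulr_suml (bigD1 (Ordinal q0)) //= big1 ?addr0.
      rewrite !mul0n !addn0 uL.1 ?(leq_trans il') ?(leq_trans jl') ?P_le //.
      rewrite eq_sym; case: eqP => _ /=; last by rewrite mul0r.
      by rewrite uL.1 ?(leq_trans jl') ?P_le.
    move=> t; rewrite -val_eqE /= -lt0n => t0.
    rewrite uL.1 ?lt // ifN ?mul0r // neq_ltn orbC.
    apply/orP; right; rewrite (leq_ltn_trans ii') // -[ltnLHS]addn0 ltn_add2l.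
    by rewrite muln_gt0 t0 psize_gt0.
  have := congr1 (fun x => u (P L) i i * x * u (P L) j j) c0.
  rewrite mulr0 mul0r mulr_sumr mulr_suml (bigD1 s) //= big1 ?addr0.
    rewrite -scalerAr -scalerAl basE ?levL ?leqnn // !eqxx => /eqP.
    by rewrite scaler_eq0 (negPf cs) (negPf (mxunits_neq0 uL iL jL)).
  move=> t ts; have [->|ct] := eqVneq (c t) 0; first by rewrite scale0r mulr0 mul0r.
  rewrite -scalerAr -scalerAl basE ?levL ?smin // ifN ?scaler0 //.
  apply: contra ts => /andP[/eqP e1 /eqP e2]; apply/eqP/val_inj/(bij_inj pi_bij).
  by rewrite [LHS]surjective_pairing [RHS]surjective_pairing e1 e2.
pose b s := bas (pi s).1 (pi s).2.
pose W x := exists m c, x = lcomb m b c.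
suff Wa : W a by have [m [c ->]] := Wa; exists m, (fun i => c i).
have pad m m' c : (m <= m')%N ->
    lcomb m b c = lcomb m' b (fun i => if (i < m)%N then c i else 0).
  move=> /subnKC <-; rewrite /lcomb big_split_ord /= [X in _ = _ + X]big1 ?addr0.
    by apply: eq_bigr => i _; rewrite ltn_ord.
  by move=> i _; rewrite ltnNge leq_addr scale0r.
have Wlin k x y : W x -> W y -> W (k *: x + y).
  move=> [m [c ->]] [l [d ->]]; exists (maxn m l).
  rewrite (pad _ _ c (leq_maxl m l)) (pad _ _ d (leq_maxr m l)) -lcomb_linear.
  by eexists.
have Wb i j : W (bas i j).
  have [pi' _ pi'K] := pi_bij; pose s := pi' (i, j).
  exists s.+1, (fun t => (t == s)%:R).
  rewrite -[LHS](_ : b s = _); last by rewrite /b /s pi'K.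
  rewrite -(sum_ord_pred1 b (ltnSn s)).
  by apply: eq_bigr => t _; case: eqP; rewrite ?scale1r ?scale0r.
have W0 : W 0 by exists 0%N, (fun=> 0); rewrite /lcomb big_ord0.
have WD x y : W x -> W y -> W (x + y) by rewrite -{2}[x]scale1r; exact: Wlin.
have Wv k i j : (i < P k)%N -> (j < P k)%N -> W (v k i j).
  elim: k i j => [|k IH] i j ik jk.
    suff E : lev i j = 0%N by have := Wb i j; rewrite /bas E.
    by apply/eqP; rewrite -leqn0 levP ik jk.
  (* A unit whose indices first come into range at level [k.+1] is a basis element. *)
  have levk i' j' : (i' < P k.+1)%N -> (j' < P k.+1)%N ->
      ~~ ((i' < P k) && (j' < P k))%N -> W (v k.+1 i' j').
    move=> i'k j'k nk; suff E : lev i' j' = k.+1 by have := Wb i' j'; rewrite /bas E.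
    by apply/eqP; rewrite eqn_leq levP i'k j'k ltnNge levP.
  have [/andP[ik' jk']|] := boolP ((i < P k) && (j < P k))%N; last exact: levk.
  have lt t x : (x < P k)%N -> (t <= n k)%N -> (x + t * P k < P k.+1)%N.
    by move=> xk tn; rewrite psizeS ltn_add_mul.
  (* Coherence writes the unit of level [k] as a sum over blocks of level [k.+1]. It is solved for
     block 0; the other blocks have indices beyond [P k], so [levk] applies to them. *)
  have := punits_coh e_units ik' jk'; rewrite psizeS mulKn ?psize_gt0 //.
  rewrite big_ord_recl /= !mul0n !addn0 => /esym/(canRL (addrK _)) ->.
  rewrite addrC -scaleN1r; apply: Wlin; last exact: IH.
  elim/big_ind: _ => // t _; apply: levk; rewrite ?lt //.
  by rewrite negb_and -!leqNgt mulSn addnCA leq_addr.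
have [k [c ->]] := full a; rewrite /mxcomb.
elim/big_ind: _ => // i _; elim/big_ind: _ => // j _.
by rewrite -[_ *: _]addr0; apply: Wlin => //; exact: Wv.
Qed.

End FullProduct.

(** The algebra of all linear operators is too large, so [A] is the span of the products of digit
    units inside it, and [full] holds by construction. *)
Lemma product_algebra_exists (F : fieldType) (n : nat -> nat) :
  (forall m, exists k, (m < psize n k)%N) ->
  exists (A : algType F) (H : set A) (u : nat -> nat -> nat -> A),
    [/\ countably_infinite_dim A, cartan_subalgebra H,
        matrix_system (divisors_of (psize n)) u &
        H = dgspan (divisors_of (psize n)) u].
Proof.
move=> Pn; pose d := @digit_unit F n.
have d_units i : mxunits (n i).+1 (d i) by exact: digit_unit_mxunits.
have d_comm i j a b c k : i != j -> (a <= n i)%N -> (b <= n i)%N ->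
    (c <= n j)%N -> (k <= n j)%N -> d i a b * d j c k = d j c k * d i a b.
  by move=> ij _ _ _ _; exact: digit_unit_comm.
pose A : algType F := subalg_of (product_span_closed d_units d_comm).
(* [insubd] needs a default value; for indices in range [valE] recovers [d i a b]. *)
pose e i a b : A := insubd 0 (d i a b).
have valE i a b : (a <= n i)%N -> (b <= n i)%N -> val (e i a b) = d i a b.
  by move=> an bn; apply: insubdK; apply/mem_set; exact: unit_product_span.
have e_units i : mxunits (n i).+1 (e i).
  have [dM d1] := d_units i; split=> [j k l m jn kn ln mn|].
    apply: val_inj; rewrite rmorphM /= !valE // dM //.
    by case: eqP => // _; rewrite valE.
  apply: val_inj; rewrite raddf_sum rmorph1 -d1.
  by apply: eq_bigr => j _; rewrite /= valE // leq_ord.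
have e_comm i j a b c k : i != j -> (a <= n i)%N -> (b <= n i)%N ->
    (c <= n j)%N -> (k <= n j)%N -> e i a b * e j c k = e j c k * e i a b.
  move=> ij an bn cn kn; apply: val_inj.
  by rewrite !rmorphM /= !valE // d_comm.
have valM : {morph (val : A -> _) : x y / x * y} by exact: rmorphM.
have val1 : val (1 : A) = 1 by exact: rmorph1.
have full a : product_span n e a.
  have /set_mem[k [c ac]] := valP a; exists k, c; apply: val_inj.
  rewrite ac raddf_sum; apply: eq_bigr => i _.
  rewrite raddf_sum; apply: eq_bigr => j _.
  rewrite /=; congr (_ *: _); apply: etrans _ (esym (big_morph _ valM val1 _ _ _)).
  by apply: eq_bigr => m _; rewrite /= valE ?digit_le.
have [u [uu ucoh uv]] := product_units e_units e_comm.
exists A, (generated_subalgebra (\bigcup_i unit_diag n e i)), u; split.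
- exact: product_countably_infinite_dim full Pn.
- exact: unit_diag_cartan.
- split=> // [|a]; first exact: dirset_psize.
  by have := full a; rewrite (product_mxspan ucoh uv).
- exact: generated_diag.
Qed.

(** The factors have the successive quotients of the chain as sizes, and the predecessor appears
    because [psize] adds one to each [n k]. The empty product accounts for [p 0 = 1]. *)
Lemma psize_chain (p : nat -> nat) :
  p 0%N = 1%N -> (forall k, (0 < p k)%N) -> (forall k, (p k %| p k.+1)%N) ->
  psize (fun k => (p k.+1 %/ p k).-1) = p.
Proof.
move=> p0 p_gt0 pd; apply/funext; elim=> [|k IH].
  by rewrite /psize big_ord0 p0.
rewrite psizeS IH prednK; first by rewrite mulnC divnK.
by rewrite divn_gt0 // dvdn_leq.
Qed.

(** * The classification *)

Lemma lrmorphism_inverse (K : nzRingType) (A B : algType K) (f : {lrmorphism A -> B}) :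
  bijective f -> exists g : {lrmorphism B -> A}, bijective g /\ forall b, f (g b) = b.
Proof.
move=> [g fK gK]; have [|||||||h [hbij hP]] :=
  @relation_lrmorphism K B A (fun b a => f a = b); last by exists h.
- by move=> b; exists (g b).
- by move=> a; exists (f a).
- by move=> k b a b' a' <- <-; rewrite linearP.
- by move=> b a b' a' <- <-; rewrite rmorphM.
- exact: rmorph1.
- by move=> a fa0; rewrite -[a]fK fa0 -(raddf0 f) fK.
- by move=> b <-; rewrite raddf0.
Qed.

Lemma standard_subspace_iso (R : realType) (S T : hammingSpace R) :
  hamming_iso S T -> forall n,
  (exists S0 : set S, hamming_subspace_iso (standard_hamming R n) S0) <->
  (exists T0 : set T, hamming_subspace_iso (standard_hamming R n) T0).
Proof.
have transfer (S' T' : hammingSpace R) : hamming_iso S' T' -> forall n,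
    (exists S0 : set S', hamming_subspace_iso (standard_hamming R n) S0) ->
    exists T0 : set T', hamming_subspace_iso (standard_hamming R n) T0.
  move=> [f [fbij fr]] n [_ [_ [g [ginj _ gr]]]].
  pose h : {lrmorphism standard_hamming R n -> T'} := f \o g.
  exists (range h); split; first exact: lrmorphism_range_closed.
  exists h; split=> // [|x]; first exact: inj_comp (bij_inj fbij) ginj.
  by rewrite /h /= fr.
move=> ST n; split; apply: transfer => //.
have [f [fbij fr]] := ST; have [g [gbij fgK]] := lrmorphism_inverse fbij.
by exists g; split=> // t; rewrite -[in RHS](fgK t) fr.
Qed.

Lemma matrix_subalgebra_iso (F : fieldType) (A B : algType F) :
  alg_iso A B -> forall n,
  (exists A0 : set A, subalgebra_iso 'M[F]_n.+1 A0) <->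
  (exists B0 : set B, subalgebra_iso 'M[F]_n.+1 B0).
Proof.
have transfer (A' B' : algType F) : alg_iso A' B' -> forall n,
    (exists A0 : set A', subalgebra_iso 'M[F]_n.+1 A0) ->
    exists B0 : set B', subalgebra_iso 'M[F]_n.+1 B0.
  move=> [f fbij] n [_ [_ [g [ginj _]]]].
  pose h : {lrmorphism 'M[F]_n.+1 -> B'} := f \o g.
  exists (range h); split; first exact: lrmorphism_range_closed.
  by exists h; split=> //; exact: inj_comp (bij_inj fbij) ginj.
move=> AB n; split; apply: transfer => //.
have [f fbij] := AB; have [g [gbij _]] := lrmorphism_inverse fbij.
by exists g.
Qed.

Theorem theorem4 (R : realType) (F : closedFieldType) :
  (forall S : hammingSpace R,
     [set: S] #= [set: nat] -> locally_standard S ->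
     exists (A : algType F) (Alm : locally_matrix A)
            (H : set A) (HC : cartan_subalgebra H),
       [/\ countably_infinite_dim A,
           hamming_iso S (idempotent_space (cartan_comm HC) R Alm) &
           st_hamming S = st_alg A]) /\
  (forall (A1 A2 : algType F)
          (Alm1 : locally_matrix A1) (Alm2 : locally_matrix A2),
     countably_infinite_dim A1 -> countably_infinite_dim A2 ->
     forall (H1 : set A1) (H2 : set A2)
            (HC1 : cartan_subalgebra H1) (HC2 : cartan_subalgebra H2),
       hamming_iso (idempotent_space (cartan_comm HC1) R Alm1)
                   (idempotent_space (cartan_comm HC2) R Alm2) <->
       alg_iso A1 A2).
Proof.
split=> [S Snat Sls|A1 A2 Alm1 Alm2 _ _ H1 H2 HC1 HC2].
  have [p [x [p0 pd sysS]]] := locally_standard_chain Snat Sls.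
  have pD k : divisors_of p (p k) by exists k.
  have p_gt0 k : (0 < p k)%N by have [[_ Dpos _ _] _ _ _] := sysS; exact: Dpos.
  have pE := psize_chain p0 p_gt0 pd.
  (* With the successive quotients as factor sizes, [A] gets a system over the same set of divisors
     as [S]. *)
  have [m|A [H [u [Adim HC]]]] :=
      @product_algebra_exists F (fun k => (p k.+1 %/ p k).-1).
    rewrite pE; have [N [k Nk] mN] := hamming_system_unbounded Snat sysS m.
    by exists k; apply: leq_trans mN _; apply: dvdn_leq.
  rewrite pE => sysA HE; have Alm := matrix_system_locally_matrix sysA.
  exists A, Alm, H, HC; split=> //.
    have [y sysH] := idem_hamming_system R (cartan_comm HC) Alm sysA HE.
    exact: hamming_system_iso sysS sysH.
  rewrite /st_hamming /st_alg (hamming_system_sizes sysS).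
  by rewrite (matrix_system_sizes R sysA).
have [D1 [u1 [sysA1 HE1]]] := cartan_matrix_system HC1.
have [D2 [u2 [sysA2 HE2]]] := cartan_matrix_system HC2.
have [x1 sysH1] := idem_hamming_system R (cartan_comm HC1) Alm1 sysA1 HE1.
have [x2 sysH2] := idem_hamming_system R (cartan_comm HC2) Alm2 sysA2 HE2.
split=> [[f [fbij fr]]|[f fbij]].
  (* Isomorphic Hamming spaces have standard subspaces of the same sizes, and these sizes make up
     [D1] and [D2]. *)
  suff D12 : D1 = D2 by apply: matrix_system_iso sysA1 _; rewrite D12; exact: sysA2.
  rewrite -(hamming_system_sizes sysH1) -(hamming_system_sizes sysH2).
  apply: (congr1 (fun X : set nat => [set n.+1 | n in X])).
  apply/predeqP => n; apply: standard_subspace_iso.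
  by exists f.
(* Likewise with the sizes of the unital matrix subalgebras. *)
suff D12 : D1 = D2 by apply: hamming_system_iso sysH1 _; rewrite D12; exact: sysH2.
rewrite -(matrix_system_sizes R sysA1) -(matrix_system_sizes R sysA2).
apply: (congr1 (fun X : set nat => [set n.+1 | n in X])).
apply/predeqP => n; apply: matrix_subalgebra_iso.
by exists f.
Qed.
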